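(* Let $k\geq 2$ be an integer and let $\phi$ be a nonzero polynomial function on $\mathbb{C}$. Then there is a unique $C^{\infty}$ function $w:\mathbb{C}\to\mathbb{R}$ satisfying $$\triangle w=e^{w}-|\phi|^2 e^{-(k-1)w}\quad\text{on } \mathbb{C}.$$
   Context: Here $z$ is the standard complex coordinate on $\mathbb{C}$ and $\triangle=4\partial_z\partial_{\bar z}$ is the standard Laplacian. No growth, boundedness or completeness condition is imposed on the solution. Nonzero constant polynomials are allowed. *)

(* Defs.v *)
From Stdlib Require Import Reals.
From Coquelicot Require Import Coquelicot.

Local Open Scope R_scope.

Definition is_polynomial (phi : C -> C) : Prop :=
  exists (n : nat) (a : nat -> C),
    forall z : C, phi z = sum_n (fun i => (a i * z ^ i)%C) n.

Definition coords (w : C -> R) : R -> R -> R := fun x y => w (x, y).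

(* [ex_diff_n f n x y] for all [x y]: every iterated partial derivative of [f]
   of order at most [n] exists and is continuous. *)
Definition smooth (w : C -> R) : Prop :=
  forall (n : nat) (x y : R), ex_diff_n (coords w) n x y.

Definition laplacian (w : C -> R) (z : C) : R :=
  partial_derive 2 0 (coords w) (Re z) (Im z)
  + partial_derive 0 2 (coords w) (Re z) (Im z).

(* Wirtinger derivatives of complex-valued functions; they appear only in
   [laplacian_wirtinger] below, which relates them to [laplacian]. *)
Definition partial_x (f : C -> C) (z : C) : C :=
  (Derive (fun t => Re (f (t, Im z))) (Re z),
   Derive (fun t => Im (f (t, Im z))) (Re z)).

Definition partial_y (f : C -> C) (z : C) : C :=
  (Derive (fun t => Re (f (Re z, t))) (Im z),
   Derive (fun t => Im (f (Re z, t))) (Im z)).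

Definition d_z (f : C -> C) (z : C) : C :=
  ((partial_x f z - Ci * partial_y f z) / 2)%C.

Definition d_zbar (f : C -> C) (z : C) : C :=
  ((partial_x f z + Ci * partial_y f z) / 2)%C.

Lemma d_zbar_real (w : C -> R) (z : C) :
  d_zbar (fun u => RtoC (w u)) z =
  (Derive (fun t => w (t, Im z)) (Re z) / 2,
   Derive (fun t => w (Re z, t)) (Im z) / 2).
Proof.
unfold d_zbar, partial_x, partial_y; cbn [Re Im fst snd RtoC].
rewrite !Derive_const.
apply injective_projections; simpl; field.
Qed.

Lemma laplacian_wirtinger (w : C -> R) (z : C) :
  smooth w ->
  RtoC (laplacian w z) = (4 * d_z (d_zbar (fun u => RtoC (w u))) z)%C.
Proof.
intros Hw; destruct z as [x y].
assert (HS := Schwarz (coords w) x y).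
unfold coords in HS.
assert (E : Derive (fun u => Derive (fun t => w (u, t)) y) x
          = Derive (fun v => Derive (fun t => w (t, v)) x) y).
{ apply HS.
  - exists (mkposreal 1 Rlt_0_1); intros u v _ _.
    destruct (Hw 2%nat u v) as (_ & A & B & (_ & _ & D & _) & (_ & F & _)).
    repeat split; assumption.
  - destruct (Hw 2%nat x y) as (_ & _ & _ & _ & (_ & _ & _ & (G & _) & _)).
    exact G.
  - destruct (Hw 2%nat x y) as (_ & _ & _ & (_ & _ & _ & _ & (G & _)) & _).
    exact G. }
unfold d_z, partial_x, partial_y, laplacian, partial_derive, coords.
cbn [Re Im fst snd Derive_n].
rewrite !(Derive_ext _ _ _ (fun t => f_equal Re (d_zbar_real w (t, y)))).
rewrite !(Derive_ext _ _ _ (fun t => f_equal Im (d_zbar_real w (t, y)))).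
rewrite !(Derive_ext _ _ _ (fun t => f_equal Re (d_zbar_real w (x, t)))).
rewrite !(Derive_ext _ _ _ (fun t => f_equal Im (d_zbar_real w (x, t)))).
cbn [Re Im fst snd].
unfold Rdiv; rewrite !Derive_scal_l, E.
set (dxx := Derive (Derive (fun t => w (t, y))) x).
set (dyy := Derive (Derive (fun t => w (x, t))) y).
set (dxy := Derive (fun v => Derive (fun t => w (t, v)) x) y).
change (RtoC (dxx + dyy) =
  (4 * (((dxx * / 2, dxy * / 2)%R - Ci * (dxy * / 2, dyy * / 2)%R) / 2))%C).
apply injective_projections; simpl; field.
Qed.

(* Main.v *)
(* Uniqueness: |phi| is bounded below near infinity, so the Keller-Osserman
   estimate, applied to - w on unit discs, bounds every solution w from below.
   The difference u of two solutions then satisfies Lap u >= c u^2 with c > 0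
   wherever u > 0, and Keller-Osserman on larger and larger discs gives u <= 0.

   Existence: the equation is discretised on the grids 2^-n Z^2.  The function
   A (1 + |z|^2) is a supersolution and - B - cos (a x) - cos (a y) a subsolution,
   and a monotone fixed-point argument gives lattice solutions u_n between them.
   A discrete interior gradient estimate, proved with the maximum principle, is
   bootstrapped to bounds for the difference quotients of u_n of every order,
   locally uniform in n.  The limit of the u_n along a free ultrafilter on nat is
   therefore smooth and solves the equation. *)

Require Import Defs.
From mathcomp Require filter.
From Stdlib Require Import Reals Lra Lia ZArith.
From Stdlib Require Import ClassicalEpsilon FunctionalExtensionality.
From Coquelicot Require Import Coquelicot.

Local Open Scope R_scope.

(** * Ultralimits of bounded sequences *)


(** Two features of the nonlinearity carry the proof: it is nondecreasing in [w], which gives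
    comparison and a monotone scheme, and it grows faster than a square, which takes the place of a
    condition at infinity. The obstacle is that the term with [phi] vanishes at the zeros of [phi].
    There a subsolution must have a positive Laplacian, yet a nonconstant function bounded above
    cannot be subharmonic on the whole plane; low-frequency cosines have a positive Laplacian
    exactly where it is needed. The grids fill the plane, so there are no boundary values and no
    exhaustion by domains, and at a single node the equation is a scalar one with an increasing left
    side. The price is that regularity must be uniform in the mesh. This rests on two algebraic
    facts: forward differences commute with the lattice Laplacian, and differences of rescaled
    exponentials are again built from rescaled exponentials. *)

(** Any ultrafilter finer than the filter of cofinite sets will do. The ultrafilter lemma used here
    speaks of the [mathcomp] notion of filter, so its axioms are transferred one by one to
    [ProperFilter] of Coquelicot. *)
Lemma free_ultrafilter_exists :
  exists G : (nat -> Prop) -> Prop,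
    ProperFilter G /\ (forall P, G P \/ G (fun n => ~ P n)) /\
    (forall N, G (fun n => (N <= n)%nat)).
Proof.
set (F := fun P : nat -> Prop => exists N, forall n, (N <= n)%nat -> P n).
assert (PF : filter.ProperFilter F).
{ constructor.
  - intros [N HN]; exact (HN N (le_n N)).
  - constructor.
    + exists O; intros n _; exact I.
    + intros P Q [N HN] [M HM]; exists (N + M)%nat; intros n Hn.
      split; [apply HN | apply HM]; lia.
    + intros P Q HPQ [N HN]; exists N; intros n Hn; apply HPQ, HN, Hn. }
destruct (filter.ultraFilterLemma PF) as (G & UG & FG).
assert (HG := filter.ultra_proper (UltraFilter := UG)).
exists G; repeat split.
- intros P HP; apply NNPP; intros H.
  apply (filter.filter_not_empty G).
  apply (filter.filterS (P := P)); [|exact HP].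
  intros n Hn; apply H; exists n; exact Hn.
- apply filter.filterT.
- intros P Q HP HQ; exact (filter.filterI HP HQ).
- intros P Q H HP; exact (filter.filterS H HP).
- intros P; exact (filter.in_ultra_setVsetC P UG).
- intros N; apply FG; exists N; trivial.
Qed.

Definition free_ultrafilter : (nat -> Prop) -> Prop :=
  proj1_sig (constructive_indefinite_description _ free_ultrafilter_exists).

Local Notation UF := free_ultrafilter.

Global Instance free_ultrafilter_proper : ProperFilter UF.
Proof.
exact (proj1 (proj2_sig (constructive_indefinite_description _ free_ultrafilter_exists))).
Qed.

Lemma free_ultrafilter_em (P : nat -> Prop) : UF P \/ UF (fun n => ~ P n).
Proof.
exact (proj1 (proj2 (proj2_sig
  (constructive_indefinite_description _ free_ultrafilter_exists))) P).
Qed.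

Lemma free_ultrafilter_eventually (P : nat -> Prop) : eventually P -> UF P.
Proof.
intros [N HN].
apply (filter_imp (fun n => (N <= n)%nat)); [exact HN|].
exact (proj2 (proj2 (proj2_sig
  (constructive_indefinite_description _ free_ultrafilter_exists))) N).
Qed.

(** The limit is the supremum of the reals that lie below [s] on a set of the ultrafilter. Since
    [l + eps / 2] is not among them, the ultrafilter property puts the complementary set, where
    [s n < l + eps / 2], into [UF]. *)
Lemma bounded_ultralimit (s : nat -> R) (M : R) :
  (forall n, Rabs (s n) <= M) -> exists l, filterlim s UF (locally l).
Proof.
intros HM.
destruct (completeness (fun x => UF (fun n => x <= s n))) as [l [Hub Hlub]].
- exists M; intros x Hx; destruct (filter_ex _ Hx) as [n Hn].
  specialize (HM n); apply Rabs_le_between in HM; lra.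
- exists (- M); apply filter_forall; intros n.
  specialize (HM n); apply Rabs_le_between in HM; lra.
- exists l; apply filterlim_locally; intros eps.
  assert (H1 : UF (fun n => l - eps < s n)).
  { apply NNPP; intros H.
    assert (l <= l - eps); [|destruct eps; simpl in *; lra].
    apply Hlub; intros x Hx; apply Rnot_lt_le; intros Hlt; apply H.
    revert Hx; apply filter_imp; intros n; lra. }
  assert (H2 : UF (fun n => ~ (l + eps / 2 <= s n))).
  { destruct (free_ultrafilter_em (fun n => l + eps / 2 <= s n)) as [H|H]; [|exact H].
    apply Hub in H; destruct eps; simpl in *; lra. }
  generalize (filter_and _ _ H1 H2); apply filter_imp; intros n [A B].
  apply Rabs_def1; destruct eps; unfold minus, plus, opp in *; simpl in *; lra.
Qed.

(** Total by choice; the value is meaningful only when an ultralimit exists, in particular for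
    bounded sequences. *)
Definition ulim (s : nat -> R) : R :=
  epsilon (inhabits 0) (fun l => filterlim s UF (locally l)).

Lemma ulim_spec (s : nat -> R) (M : R) :
  (forall n, Rabs (s n) <= M) -> filterlim s UF (locally (ulim s)).
Proof. intros H; exact (epsilon_spec _ _ (bounded_ultralimit s M H)). Qed.

Lemma filterlim_2d {T : Type} (F : (T -> Prop) -> Prop) {FF : Filter F} (f : R -> R -> R)
  (u v : T -> R) (x y : R) :
  continuity_2d_pt f x y -> filterlim u F (locally x) -> filterlim v F (locally y) ->
  filterlim (fun t => f (u t) (v t)) F (locally (f x y)).
Proof.
intros Hf Hu Hv; apply filterlim_locally; intros eps.
destruct (Hf eps) as [d Hd].
generalize (filter_and _ _ (proj1 (filterlim_locally _ _) Hu d)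
  (proj1 (filterlim_locally _ _) Hv d)).
apply filter_imp; intros t [A B]; apply Hd; assumption.
Qed.

(** Extreme value theorem on a compact set. Compactness enters through the ultralimits of the two
    coordinates of a maximising sequence, which exist by boundedness and stay in the set by
    continuity of [g]. *)
Lemma maximum_on_superlevel (f g : R -> R -> R) (B x0 y0 : R) :
  (forall x y, continuity_2d_pt f x y) -> (forall x y, continuity_2d_pt g x y) ->
  (forall x y, 0 <= g x y -> Rabs x <= B /\ Rabs y <= B) -> 0 <= g x0 y0 ->
  exists x y, 0 <= g x y /\ forall u v, 0 <= g u v -> f u v <= f x y.
Proof.
intros Hf Hg HB H0.
(* Composing with the increasing function [atan] makes [f] bounded. *)
destruct (completeness (fun t => exists x y, 0 <= g x y /\ t = atan (f x y)))
  as [S [Hub Hlub]].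
- exists (PI / 2); intros t (x & y & _ & ->); left; apply atan_bound.
- exists (atan (f x0 y0)), x0, y0; auto.
- assert (HS : forall n : nat, exists p : R * R,
    0 <= g (fst p) (snd p) /\ S - / (INR n + 1) < atan (f (fst p) (snd p))).
  { intros n; apply NNPP; intros H.
    assert (Hn : 0 < / (INR n + 1)) by (apply Rinv_0_lt_compat; generalize (pos_INR n); lra).
    assert (S <= S - / (INR n + 1)); [|lra].
    apply Hlub; intros t (x & y & Hxy & ->); apply Rnot_lt_le; intros Hlt.
    apply H; exists (x, y); auto. }
  set (p := fun n => proj1_sig (constructive_indefinite_description _ (HS n))).
  assert (Hp : forall n, 0 <= g (fst (p n)) (snd (p n)) /\
     S - / (INR n + 1) < atan (f (fst (p n)) (snd (p n)))).
  { intros n; exact (proj2_sig (constructive_indefinite_description _ (HS n))). }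
  clearbody p.
  destruct (bounded_ultralimit (fun n => fst (p n)) B) as [x Hx].
  { intros n; apply (HB _ _ (proj1 (Hp n))). }
  destruct (bounded_ultralimit (fun n => snd (p n)) B) as [y Hy].
  { intros n; apply (HB _ _ (proj1 (Hp n))). }
  exists x, y; split.
  + apply (filterlim_le (F := UF) (fun _ => 0) (fun n => g (fst (p n)) (snd (p n))) 0 (g x y)).
    * apply filter_forall; intros n; apply Hp.
    * apply filterlim_const.
    * apply (filterlim_2d UF g); auto.
  + intros u v Huv.
    assert (HSxy : S <= atan (f x y)).
    { apply (filterlim_le (F := UF) (fun n => S - / (INR n + 1))
        (fun n => atan (f (fst (p n)) (snd (p n)))) S (atan (f x y))).
      - apply filter_forall; intros n; left; apply Hp.
      - assert (H : is_lim_seq (fun n => S - / (INR n + 1)) (S - 0)).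
        { apply is_lim_seq_minus'; [apply is_lim_seq_const|].
          apply (is_lim_seq_ext (fun n => / INR (Datatypes.S n))).
          { intros n; rewrite S_INR; reflexivity. }
          apply (is_lim_seq_incr_1 (fun n => / INR n)).
          change (Finite 0) with (Rbar_inv p_infty).
          apply is_lim_seq_inv; [apply is_lim_seq_INR | discriminate]. }
        rewrite Rminus_0_r in H; intros P HP; apply free_ultrafilter_eventually, H, HP.
      - apply (filterlim_comp _ _ _ _ atan UF (locally (f x y)) (locally (atan (f x y)))).
        + apply (filterlim_2d UF f); auto.
        + apply (continuity_pt_filterlim atan), derivable_continuous_pt, derivable_pt_atan. }
    apply Rnot_lt_le; intros Hlt; apply atan_increasing in Hlt.
    assert (atan (f u v) <= S) by (apply Hub; exists u, v; auto); lra.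
Qed.

(** * The Keller-Osserman estimate *)


(** If [l] were positive, [h1] would be positive just to the right of [x], and by the mean value
    theorem [h] would exceed [h x] there. *)
Lemma derivatives_at_local_max (h h1 : R -> R) (x l d : R) :
  0 < d -> (forall t, is_derive h t (h1 t)) -> is_derive h1 x l ->
  (forall t, Rabs (t - x) < d -> h t <= h x) -> h1 x = 0 /\ l <= 0.
Proof.
intros Hd Hh Hl Hmax.
assert (E : h1 x = 0).
{ assert (pr : derivable_pt h x) by (apply ex_derive_Reals_0; eexists; apply Hh).
  rewrite <- (is_derive_unique _ _ _ (Hh x)), <- (Derive_Reals h x pr).
  apply deriv_maximum with (a := x - d) (b := x + d); [lra..|].
  intros t Ht1 Ht2; apply Hmax, Rabs_def1; lra. }
split; [exact E|].
apply Rnot_lt_le; intros Hpos.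
apply is_derive_Reals in Hl.
destruct (Hl (l / 2)) as [e He]; [lra|].
set (m := Rmin (d / 2) (e / 2)).
assert (Hm : 0 < m /\ m <= d / 2 /\ m <= e / 2).
{ destruct e as [e he]; simpl in *; unfold m; repeat split;
    [apply Rmin_glb_lt; lra | apply Rmin_l | apply Rmin_r]. }
assert (He2 : 0 < e) by apply cond_pos.
destruct (MVT_cor2 h h1 x (x + m)) as (c & Hc & Hc2); [lra| |].
{ intros t _; apply is_derive_Reals, Hh. }
assert (H1 : h (x + m) <= h x) by (apply Hmax; rewrite Rabs_right; lra).
specialize (He (c - x)).
rewrite E in He; replace (x + (c - x)) with c in He by ring.
assert (Hq : Rabs ((h1 c - 0) / (c - x) - l) < l / 2).
{ apply He; [lra | rewrite Rabs_right; lra]. }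
apply Rabs_def2 in Hq.
assert (h1 c = (h1 c - 0) / (c - x) * (c - x)) by (field; lra).
assert (0 < h1 c) by (rewrite H; apply Rmult_lt_0_compat; lra).
assert (0 < h1 c * (x + m - x)) by (apply Rmult_lt_0_compat; lra).
lra.
Qed.

(* The bump function is [(c - (t - x0)^2)^2]; eliminating [V'] with the
   first-order condition leaves a bound for [V'']. *)
Lemma second_derivative_bound (V V1 : R -> R) (V2 c x0 x d : R) :
  0 < d -> (forall t, is_derive V t (V1 t)) -> is_derive V1 x V2 ->
  let s := c - (x - x0) ^ 2 in
  0 < s ->
  (forall t, Rabs (t - x) < d ->
     V t * (c - (t - x0) ^ 2) ^ 2 <= V x * s ^ 2) ->
  V2 * s ^ 2 <= V x * (24 * (x - x0) ^ 2 + 4 * s).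
Proof.
intros Hd HV HV1 s Hs Hmax.
set (p := fun t => (c - (t - x0) ^ 2) ^ 2).
set (p1 := fun t => - 4 * (t - x0) * (c - (t - x0) ^ 2)).
set (p2 := fun t => 8 * (t - x0) ^ 2 - 4 * (c - (t - x0) ^ 2)).
assert (Hp : forall t, is_derive p t (p1 t)).
{ intros t; unfold p, p1; auto_derive; [trivial|ring]. }
assert (Hp1 : forall t, is_derive p1 t (p2 t)).
{ intros t; unfold p1, p2; auto_derive; [trivial|ring]. }
destruct (derivatives_at_local_max (fun t => V t * p t)
  (fun t => V1 t * p t + V t * p1 t) x
  ((V2 * p x + V1 x * p1 x) + (V1 x * p1 x + V x * p2 x)) d Hd) as [A B].
- intros t; apply (is_derive_mult V p); auto; intros; apply Rmult_comm.
- apply (is_derive_plus (fun t => V1 t * p t) (fun t => V t * p1 t)).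
  + apply (is_derive_mult V1 p); auto; intros; apply Rmult_comm.
  + apply (is_derive_mult V p1); auto; intros; apply Rmult_comm.
- exact Hmax.
- unfold p, p1, p2 in A, B; fold s in A, B.
  assert (A' : V1 x * s = 4 * V x * (x - x0)).
  { apply Rmult_eq_reg_r with s; [nra | lra]. }
  assert (B' : V1 x * (-4 * (x - x0) * s) = -16 * V x * (x - x0) ^ 2).
  { replace (V1 x * (-4 * (x - x0) * s)) with (-4 * (x - x0) * (V1 x * s)) by ring.
    rewrite A'; ring. }
  rewrite B' in B; nra.
Qed.

(** What a maximum principle along the two axes consumes: continuity, so that maxima exist on
    compact sets, and the pure second derivatives. These are parameters because the estimates
    mention them; the first derivatives are only asserted to exist. *)
Record C2 (v vxx vyy : R -> R -> R) : Prop := {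
  C2_continuous : forall x y, continuity_2d_pt v x y;
  C2_x : exists vx : R -> R -> R, forall x y,
    is_derive (fun t => v t y) x (vx x y) /\ is_derive (fun t => vx t y) x (vxx x y);
  C2_y : exists vy : R -> R -> R, forall x y,
    is_derive (fun t => v x t) y (vy x y) /\ is_derive (fun t => vy x t) y (vyy x y) }.

Lemma Rabs_le_of_sqr (t r : R) : 0 <= r -> t ^ 2 <= r ^ 2 -> Rabs t <= r.
Proof.
intros Hr H; apply Rsqr_incr_0_var; [|exact Hr].
rewrite <- Rsqr_abs; unfold Rsqr; lra.
Qed.

(* Keller-Osserman: apply the maximum principle to [(v - K) s^2] with
   [s = rho^2 - |z - z0|^2]. *)
Lemma keller_osserman (v vxx vyy : R -> R -> R) (a b K rho x0 y0 : R) :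
  C2 v vxx vyy -> 0 < a -> 0 < rho -> 0 <= K -> b <= a * K ^ 2 ->
  (forall x y, (x - x0) ^ 2 + (y - y0) ^ 2 < rho ^ 2 -> 0 < v x y ->
     a * v x y ^ 2 - b <= vxx x y + vyy x y) ->
  v x0 y0 <= K + 24 / (a * rho ^ 2).
Proof.
intros [Hc [vx Hx] [vy Hy]] Ha Hrho HK Hb Hv.
apply Rnot_lt_le; intros Hlt.
set (s := fun x y => rho ^ 2 - (x - x0) ^ 2 - (y - y0) ^ 2).
set (G := fun x y => (v x y - K) * (s x y * s x y)).
assert (cs : forall x y, continuity_2d_pt s x y).
{ intros x y; unfold s; simpl.
  repeat first [apply continuity_2d_pt_const |
    apply continuity_2d_pt_minus | apply continuity_2d_pt_mult |
    apply continuity_2d_pt_id1 | apply continuity_2d_pt_id2]. }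
assert (cG : forall x y, continuity_2d_pt G x y).
{ intros x y; unfold G.
  repeat first [apply cs | apply Hc | apply continuity_2d_pt_const |
    apply continuity_2d_pt_minus | apply continuity_2d_pt_mult]. }
assert (Hr2 : 0 < rho ^ 2) by (apply pow_lt; lra).
destruct (maximum_on_superlevel G s (rho + Rabs x0 + Rabs y0) x0 y0 cG cs)
  as (x & y & Hs & Hmax).
{ intros x y Hs; unfold s in Hs.
  assert (Rabs (x - x0) <= rho)
    by (apply Rabs_le_of_sqr; [lra | generalize (pow2_ge_0 (y - y0)); lra]).
  assert (Rabs (y - y0) <= rho)
    by (apply Rabs_le_of_sqr; [lra | generalize (pow2_ge_0 (x - x0)); lra]).
  generalize (Rabs_triang (x - x0) x0) (Rabs_triang (y - y0) y0) (Rabs_pos x0) (Rabs_pos y0).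
  replace (x - x0 + x0) with x by ring; replace (y - y0 + y0) with y by ring; lra. }
{ unfold s; nra. }
assert (E0 : s x0 y0 = rho ^ 2) by (unfold s; ring).
assert (HG0 : 24 / a * rho ^ 2 < G x0 y0).
{ unfold G; rewrite E0.
  replace (24 / a * rho ^ 2) with (24 / (a * rho ^ 2) * (rho ^ 2 * rho ^ 2)) by (field; lra).
  apply Rmult_lt_compat_r; [nra | lra]. }
assert (HG : 24 / a * rho ^ 2 < G x y).
{ assert (G x0 y0 <= G x y) by (apply Hmax; rewrite E0; lra); lra. }
assert (Ha24 : 0 < 24 / a) by (apply Rdiv_lt_0_compat; lra).
assert (HGpos : 0 < G x y) by (assert (0 < 24 / a * rho ^ 2) by (apply Rmult_lt_0_compat; lra); lra).
assert (Hs' : 0 < s x y).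
{ destruct Hs as [Hs|Hs]; [exact Hs|].
  unfold G in HGpos; rewrite <- Hs in HGpos; lra. }
set (V := v x y - K).
assert (HV : 0 < V).
{ apply Rnot_le_lt; intros H; unfold G in HGpos; fold V in HGpos.
  assert (V * (s x y * s x y) <= 0) by (assert (0 < s x y * s x y) by nra; nra); lra. }
destruct (cs x y (mkposreal _ Hs')) as [d Hd].
assert (Hpos : forall u w, Rabs (u - x) < d -> Rabs (w - y) < d -> 0 <= s u w).
{ intros u w Hu Hw; specialize (Hd u w Hu Hw); simpl in Hd; apply Rabs_def2 in Hd; lra. }
assert (Hdd : 0 < d) by apply cond_pos.
assert (H0 : forall t : R, Rabs (t - t) < d) by (intros t; rewrite Rminus_eq_0, Rabs_R0; lra).
assert (Bx := second_derivative_bound (fun t => v t y - K) (fun t => vx t y)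
   (vxx x y) (rho ^ 2 - (y - y0) ^ 2) x0 x d Hdd).
assert (By := second_derivative_bound (fun t => v x t - K) (fun t => vy x t)
   (vyy x y) (rho ^ 2 - (x - x0) ^ 2) y0 y d Hdd).
cbv zeta in Bx, By.
replace (rho ^ 2 - (y - y0) ^ 2 - (x - x0) ^ 2) with (s x y) in Bx by (unfold s; ring).
replace (rho ^ 2 - (x - x0) ^ 2 - (y - y0) ^ 2) with (s x y) in By by (unfold s; ring).
fold V in Bx, By.
assert (Bx' : vxx x y * s x y ^ 2 <= V * (24 * (x - x0) ^ 2 + 4 * s x y)).
{ apply Bx; trivial.
  - intros t; rewrite <- (Rminus_0_r (vx t y)).
    apply (is_derive_minus (fun t => v t y) (fun _ => K)); [apply Hx|exact (is_derive_const K t)].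
  - apply Hx.
  - intros t Ht.
    assert (H := Hmax t y (Hpos t y Ht (H0 y))).
    unfold G in H; fold V in H.
    eapply Rle_trans; [|eapply Rle_trans; [exact H|]]; right; unfold s; ring. }
assert (By' : vyy x y * s x y ^ 2 <= V * (24 * (y - y0) ^ 2 + 4 * s x y)).
{ apply By; trivial.
  - intros t; rewrite <- (Rminus_0_r (vy x t)).
    apply (is_derive_minus (fun t => v x t) (fun _ => K)); [apply Hy|exact (is_derive_const K t)].
  - apply Hy.
  - intros t Ht.
    assert (H := Hmax x t (Hpos x t (H0 x) Ht)).
    unfold G in H; fold V in H.
    eapply Rle_trans; [|eapply Rle_trans; [exact H|]]; right; unfold s; ring. }
clear Bx By.
(* Subtracting [K] absorbs the constant [b]: by [b <= a * K ^ 2], the quantity [a * (V + K) ^ 2 - b]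
   is at least [a * V ^ 2]. *)
assert (HL : a * V ^ 2 <= vxx x y + vyy x y).
{ eapply Rle_trans; [|apply Hv].
  - replace (v x y) with (V + K) by (unfold V; ring).
    assert (0 <= a * (V * K)) by (apply Rmult_le_pos; [lra | apply Rmult_le_pos; lra]); nra.
  - unfold s in Hs'; lra.
  - unfold V in HV; lra. }
assert (Er : (x - x0) ^ 2 + (y - y0) ^ 2 = rho ^ 2 - s x y) by (unfold s; ring).
(* The two one-dimensional bounds add up to [24 |z - z0|^2 + 8 s], which is [24 rho^2 - 16 s]; this
   is the origin of the constant 24. *)
assert (HLL : (vxx x y + vyy x y) * s x y ^ 2 <= V * (24 * rho ^ 2)).
{ apply Rle_trans with (V * (24 * ((x - x0) ^ 2 + (y - y0) ^ 2) + 8 * s x y)); [lra|].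
  apply Rmult_le_compat_l; lra. }
assert (H1 : a * V ^ 2 * s x y ^ 2 <= V * (24 * rho ^ 2)).
{ eapply Rle_trans; [|exact HLL].
  apply Rmult_le_compat_r; [apply pow2_ge_0 | exact HL]. }
assert (H2 : a * (V * s x y ^ 2) <= 24 * rho ^ 2).
{ apply Rmult_le_reg_l with V; [exact HV|].
  eapply Rle_trans; [|exact H1]; right; ring. }
assert (H3 : V * s x y ^ 2 <= 24 / a * rho ^ 2).
{ apply Rmult_le_reg_l with a; [exact Ha|].
  eapply Rle_trans; [exact H2|]; right; field; lra. }
unfold G in HG; fold V in HG; simpl in H3; lra.
Qed.

Lemma keller_osserman_entire (v vxx vyy : R -> R -> R) (a : R) :
  C2 v vxx vyy -> 0 < a ->
  (forall x y, 0 < v x y -> a * v x y ^ 2 <= vxx x y + vyy x y) ->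
  forall x y, v x y <= 0.
Proof.
intros H Ha Hv x y; apply Rnot_lt_le; intros Hpos.
(* For this radius [a * v x y * rho ^ 2 >= a * v x y * rho >= 25], whereas the estimate with
   [b = K = 0] bounds the left side by 24. *)
set (rho := Rmax 1 (25 / (a * v x y))).
assert (Hav : 0 < a * v x y) by (apply Rmult_lt_0_compat; lra).
assert (Hr1 : 1 <= rho) by apply Rmax_l.
assert (Hr2 : 25 / (a * v x y) <= rho) by apply Rmax_r.
assert (Hle : v x y <= 0 + 24 / (a * rho ^ 2)).
{ apply (keller_osserman v vxx vyy a 0 0); trivial; try lra.
  intros u w _ Huw; specialize (Hv u w Huw); lra. }
assert (Hr3 : 25 <= a * v x y * rho).
{ apply Rmult_le_reg_r with (/ (a * v x y)); [apply Rinv_0_lt_compat; lra|].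
  eapply Rle_trans; [exact Hr2|right; field; lra]. }
assert (Har : 0 < a * rho ^ 2) by (apply Rmult_lt_0_compat; [lra | apply pow_lt; lra]).
assert (Hle2 : v x y * (a * rho ^ 2) <= 24).
{ rewrite Rplus_0_l in Hle.
  apply Rmult_le_compat_r with (r := a * rho ^ 2) in Hle; [|lra].
  eapply Rle_trans; [exact Hle|right; field; lra]. }
nra.
Qed.

(** * Polynomials and uniqueness *)


(** Horner's scheme as an induction principle. All facts about polynomials below (growth from both
    sides, difference quotients, continuity) then reduce to multiplying by [z] and adding a
    constant. *)
Lemma polynomial_horner_ind (P : (C -> C) -> Prop) :
  (forall c, P (fun _ => c)) ->
  (forall c f, P f -> P (fun z => (c + z * f z)%C)) ->
  forall phi, is_polynomial phi -> P phi.
Proof.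
intros P0 PS phi (n & a & H).
replace phi with (fun z => sum_n (fun i => (a i * z ^ i)%C) n)
  by (apply functional_extensionality; intros z; rewrite H; reflexivity).
clear phi H; revert a; induction n as [|n IH]; intros a.
- replace (fun z => _) with (fun _ : C => a O); [apply P0|].
  apply functional_extensionality; intros z; rewrite sum_O; simpl; ring.
- replace (fun z => _) with
    (fun z => (a O + z * sum_n (fun i => a (S i) * z ^ i) n)%C).
  + apply (PS (a O)), (IH (fun i => a (S i))).
  + apply functional_extensionality; intros z.
    unfold sum_n; rewrite (sum_Sn_m (fun i => (a i * z ^ i)%C)) by lia.
    rewrite <- sum_n_m_S.
    replace (a O * z ^ 0)%C with (a O) by (simpl; ring).
    change (plus (a O)) with (Cplus (a O)); f_equal.
    rewrite <- (sum_n_m_mult_l (K := C_Ring) z).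
    apply sum_n_m_ext; intros i; rewrite Cpow_S.
    change mult with Cmult; rewrite !Cmult_assoc, (Cmult_comm z (a (S i))); reflexivity.
Qed.

(** Stated as a dichotomy so that the Horner induction can carry it: the inner factor of a nonzero
    polynomial may vanish identically. *)
Lemma polynomial_lower_bound (phi : C -> C) :
  is_polynomial phi ->
  (forall z, phi z = 0%C) \/
  exists r c, 0 < c /\ 0 <= r /\ forall z, r <= Cmod z -> c <= Cmod (phi z).
Proof.
revert phi.
assert (K : forall c : C, (forall z : C, c = 0%C) \/
  exists r d, 0 < d /\ 0 <= r /\ forall z, r <= Cmod z -> d <= Cmod c).
{ intros c; destruct (Ceq_dec c 0) as [E|E]; [left; auto | right].
  exists 0, (Cmod c); split; [apply Cmod_gt_0, E | split; intros; lra]. }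
apply (polynomial_horner_ind (fun phi => _ \/ _)); [exact K|].
intros a f [H|(r & c & Hc & Hr & H)].
- destruct (K a) as [E|(r & d & Hd & Hr & E)]; [left | right].
  + intros z; rewrite H, (E z); ring.
  + exists r, d; split; [exact Hd | split; [exact Hr|]]; intros z Hz; rewrite H.
    replace (a + z * 0)%C with a by ring; exact (E z Hz).
(* Beyond this radius [|z| >= 1 + |a| / c], hence [|z f(z)| >= c + |a|] and adding [a] leaves at
   least [c]. *)
- right; exists (r + 1 + Cmod a / c), c.
  assert (0 <= Cmod a / c).
  { apply Rmult_le_pos; [apply Cmod_ge_0 | left; apply Rinv_0_lt_compat, Hc]. }
  split; [exact Hc | split; [lra|]]; intros z Hz.
  assert (c <= Cmod (f z)) by (apply H; lra).
  assert (T : Cmod (z * f z) <= Cmod (a + z * f z) + Cmod a).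
  { replace (z * f z)%C with ((a + z * f z) + - a)%C at 1 by ring.
    eapply Rle_trans; [apply Cmod_triangle | rewrite Cmod_opp; lra]. }
  rewrite Cmod_mult in T.
  assert (E : Cmod a = Cmod a / c * c) by (field; lra).
  assert (c + Cmod a <= Cmod z * Cmod (f z)).
  { apply Rle_trans with (Cmod z * c).
    - rewrite E at 1; replace (c + Cmod a / c * c) with ((1 + Cmod a / c) * c) by ring.
      apply Rmult_le_compat_r; lra.
    - apply Rmult_le_compat_l; [apply Cmod_ge_0 | assumption]. }
  lra.
Qed.

(** The crude exponential form is cut to the supersolution [A (1 + |z|^2)], whose exponential must
    dominate [|phi|^2]. *)
Lemma polynomial_upper_bound (phi : C -> C) :
  is_polynomial phi ->
  exists A, 0 <= A /\ forall z, Cmod (phi z) <= exp (A * (1 + Cmod z ^ 2)).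
Proof.
revert phi; apply (polynomial_horner_ind (fun phi => exists A, _)).
- intros c; exists (Cmod c); split; [apply Cmod_ge_0|]; intros z.
  generalize (exp_ineq1_le (Cmod c * (1 + Cmod z ^ 2))) (Cmod_ge_0 c) (pow2_ge_0 (Cmod z)); nra.
(* One unit of the exponent pays for the factor [z], and [Cmod a] units pay for the added
   constant. *)
- intros a f (A & HA & H); exists (A + 1 + Cmod a).
  assert (Ha := Cmod_ge_0 a); split; [lra|]; intros z.
  set (s := 1 + Cmod z ^ 2).
  assert (Hs : 1 <= s) by (unfold s; generalize (pow2_ge_0 (Cmod z)); lra).
  eapply Rle_trans; [apply Cmod_triangle|]; rewrite Cmod_mult.
  replace ((A + 1 + Cmod a) * s) with (Cmod a * s + (s + A * s)) by ring.
  rewrite !exp_plus.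
  assert (H1 : 1 + Cmod a <= exp (Cmod a * s)).
  { eapply Rle_trans; [|apply exp_ineq1_le]; nra. }
  assert (H2 : Cmod z <= exp s).
  { eapply Rle_trans; [|apply exp_ineq1_le]; unfold s; nra. }
  assert (H3 : 1 <= exp s * exp (A * s)).
  { rewrite <- exp_plus; eapply Rle_trans; [|apply exp_ineq1_le]; nra. }
  assert (H4 : Cmod z * Cmod (f z) <= exp s * exp (A * s)).
  { apply Rmult_le_compat; try apply Cmod_ge_0; [exact H2 | apply H]. }
  apply Rle_trans with ((1 + Cmod a) * (exp s * exp (A * s))); [nra|].
  apply Rmult_le_compat_r; lra.
Qed.

(** The square of [1 + x / 2 <= exp (x / 2)]. Its quadratic term is what feeds the Keller-Osserman
    estimate. *)
Lemma exp_ge_quadratic (x : R) : 0 <= x -> 1 + x + x ^ 2 / 4 <= exp x.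
Proof.
intros Hx; replace x with (x / 2 + x / 2) at 3 by field; rewrite exp_plus.
generalize (exp_ineq1_le (x / 2)); nra.
Qed.

Lemma C2_of_smooth (w : C -> R) :
  smooth w ->
  C2 (coords w) (partial_derive 2 0 (coords w)) (partial_derive 0 2 (coords w)).
Proof.
intros Hw; split.
- intros x y; exact (proj1 (Hw O x y)).
- exists (fun x y => Derive (fun t => coords w t y) x); intros x y.
  destruct (Hw 2%nat x y) as (_ & A & _ & (_ & B & _) & _).
  split; [exact (Derive_correct _ _ A) | exact (Derive_correct _ _ B)].
- exists (fun x y => Derive (fun t => coords w x t) y); intros x y.
  destruct (Hw 2%nat x y) as (_ & _ & A & _ & (_ & _ & B & _)).
  split; [exact (Derive_correct _ _ A) | exact (Derive_correct _ _ B)].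
Qed.

Lemma C2_opp (v vxx vyy : R -> R -> R) :
  C2 v vxx vyy ->
  C2 (fun x y => - v x y) (fun x y => - vxx x y) (fun x y => - vyy x y).
Proof.
intros [Hc [vx Hx] [vy Hy]]; split.
- intros x y; apply continuity_2d_pt_opp, Hc.
- exists (fun x y => - vx x y); intros x y.
  split; apply (is_derive_opp (V := R_NormedModule)); apply Hx.
- exists (fun x y => - vy x y); intros x y.
  split; apply (is_derive_opp (V := R_NormedModule)); apply Hy.
Qed.

Lemma C2_minus (u uxx uyy v vxx vyy : R -> R -> R) :
  C2 u uxx uyy -> C2 v vxx vyy ->
  C2 (fun x y => u x y - v x y) (fun x y => uxx x y - vxx x y)
     (fun x y => uyy x y - vyy x y).
Proof.
intros [Hc [ux Hx] [uy Hy]] [Hc' [vx Hx'] [vy Hy']]; split.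
- intros x y; apply continuity_2d_pt_minus; [apply Hc | apply Hc'].
- exists (fun x y => ux x y - vx x y); intros x y.
  split; apply (is_derive_minus (V := R_NormedModule)); first [apply Hx | apply Hx'].
- exists (fun x y => uy x y - vy x y); intros x y.
  split; apply (is_derive_minus (V := R_NormedModule)); first [apply Hy | apply Hy'].
Qed.

(** * Lower bound and comparison of solutions *)

Definition rhs (k : nat) (q t : R) : R := exp t - q * exp (- (INR k - 1) * t).

(** Where [|phi| >= c] and [t = - w] is positive, the Laplacian of [t] is at least [c^2 exp t - 1],
    hence at least [(c^2 / 4) t^2 - 1]. The remaining compact disc is given radius [r + 1], so that
    unit discs centred outside it stay in the region [|z| >= r]. *)
Lemma solution_bounded_below (k : nat) (phi : C -> C) (w : C -> R) :
  (2 <= k)%nat -> is_polynomial phi -> (exists z : C, phi z <> 0%C) -> smooth w ->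
  (forall z, laplacian w z = rhs k (Cmod (phi z) ^ 2) (w z)) ->
  exists c, forall z, - c <= w z.
Proof.
intros Hk Hphi [z1 Hz1] Hw Heq.
destruct (polynomial_lower_bound phi Hphi) as [H|(r & c & Hc & Hr & H)];
  [contradiction (Hz1 (H z1))|].
assert (HC2 := C2_opp _ _ _ (C2_of_smooth w Hw)).
destruct (maximum_on_superlevel (fun x y => - coords w x y)
  (fun x y => (r + 1) * (r + 1) - x * x - y * y) (r + 1) 0 0) as (x & y & Hxy & Hmax).
- apply HC2.
- intros x y.
  repeat first [apply continuity_2d_pt_const |
    apply continuity_2d_pt_minus | apply continuity_2d_pt_mult |
    apply continuity_2d_pt_id1 | apply continuity_2d_pt_id2].
- intros x y Hxy; split; apply Rabs_le_of_sqr; nra.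
- nra.
- exists (Rmax (- coords w x y) (2 / c + 24 / (c ^ 2 / 4 * 1 ^ 2))); intros [x0 y0].
  assert (Hk2 : 2 <= INR k) by (apply (le_INR 2), Hk).
  destruct (Rle_lt_dec 0 ((r + 1) * (r + 1) - x0 * x0 - y0 * y0)) as [Hin|Hout].
  + generalize (Hmax x0 y0 Hin) (Rmax_l (- coords w x y) (2 / c + 24 / (c ^ 2 / 4 * 1 ^ 2))).
    unfold coords; lra.
  + assert (Hc2 : 0 < c ^ 2) by (apply pow_lt, Hc).
    assert (Hv : - coords w x0 y0 <= 2 / c + 24 / (c ^ 2 / 4 * 1 ^ 2)).
    (* [K = 2 / c] is the solution of [(c ^ 2 / 4) * K ^ 2 = 1]. *)
    { apply (keller_osserman _ _ _ (c ^ 2 / 4) 1 (2 / c) 1 x0 y0 HC2); try lra.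
      - apply Rlt_le, Rdiv_lt_0_compat; lra.
      - right; field; lra.
      - intros u v Huv Hpos.
        assert (E := Heq (u, v)); unfold laplacian in E; simpl Re in E; simpl Im in E.
        assert (HM : r <= Cmod (u, v)).
        { assert (T := Cmod_triangle (u, v) (x0 - u, y0 - v)%R).
          replace (Cplus (u, v) (x0 - u, y0 - v)) with ((x0, y0) : C) in T
            by (unfold Cplus; simpl; f_equal; ring).
          assert (T1 : Cmod (x0 - u, y0 - v) <= 1).
          { unfold Cmod; cbn [fst snd]; rewrite <- sqrt_1; apply sqrt_le_1_alt; lra. }
          assert (T2 : r + 1 <= Cmod (x0, y0)).
          { unfold Cmod; simpl; rewrite <- (sqrt_square (r + 1)) by lra.
            apply sqrt_le_1_alt; nra. }
          lra. }
        assert (Hq : c ^ 2 <= Cmod (phi (u, v)) ^ 2) by (apply pow_incr; split; [lra|auto]).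
        set (t := - coords w u v) in *.
        replace (w (u, v)) with (- t) in E by (unfold t, coords; ring).
        unfold rhs in E.
        assert (E1 : exp (- t) <= 1).
        { rewrite <- exp_0; left; apply exp_increasing; lra. }
        assert (E2 : t ^ 2 / 4 <= exp (- (INR k - 1) * - t)).
        { apply Rle_trans with (exp t); [generalize (exp_ge_quadratic t); lra|].
          destruct (Req_dec t (- (INR k - 1) * - t)) as [<-|Hne]; [lra|].
          left; apply exp_increasing; nra. }
        assert (c ^ 2 * (t ^ 2 / 4) <= Cmod (phi (u, v)) ^ 2 * exp (- (INR k - 1) * - t)).
        { apply Rmult_le_compat; [lra | generalize (pow2_ge_0 t); lra | exact Hq | exact E2]. }
        lra. }
    generalize (Rmax_r (- coords w x y) (2 / c + 24 / (c ^ 2 / 4 * 1 ^ 2))).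
    unfold coords in Hv; lra.
Qed.

(** Where [u = w1 - w2] is positive, the terms with [phi] have the favourable sign, and
    [exp w1 - exp w2 = exp w2 (exp u - 1)] is at least [exp (- c) u^2 / 4]. The lower bound [- c]
    for [w2] makes this constant uniform over the plane. *)
Lemma solution_le (k : nat) (phi : C -> C) (w1 w2 : C -> R) :
  (2 <= k)%nat -> is_polynomial phi -> (exists z : C, phi z <> 0%C) ->
  smooth w1 -> (forall z, laplacian w1 z = rhs k (Cmod (phi z) ^ 2) (w1 z)) ->
  smooth w2 -> (forall z, laplacian w2 z = rhs k (Cmod (phi z) ^ 2) (w2 z)) ->
  forall z, w1 z <= w2 z.
Proof.
intros Hk Hphi Hz S1 E1 S2 E2.
assert (Hk2 : 2 <= INR k) by (apply (le_INR 2), Hk).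
destruct (solution_bounded_below k phi w2) as [c Hc]; trivial.
assert (H : forall x y, coords w1 x y - coords w2 x y <= 0).
{ apply (keller_osserman_entire _ _ _ (exp (- c) / 4)
    (C2_minus _ _ _ _ _ _ (C2_of_smooth w1 S1) (C2_of_smooth w2 S2))).
  - generalize (exp_pos (- c)); lra.
  - intros x y Hpos.
    assert (F1 := E1 (x, y)); assert (F2 := E2 (x, y)).
    unfold laplacian in F1, F2; simpl Re in F1, F2; simpl Im in F1, F2.
    specialize (Hc (x, y)); unfold rhs in F1, F2; unfold coords in Hpos |- *.
    fold (coords w1) (coords w2).
    set (a := w1 (x, y)) in *; set (b := w2 (x, y)) in *.
    set (q := Cmod (phi (x, y)) ^ 2) in *.
    assert (Hq : 0 <= q) by apply pow2_ge_0.
    assert (G1 : exp (- (INR k - 1) * a) <= exp (- (INR k - 1) * b)).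
    { left; apply exp_increasing; nra. }
    assert (G2 : exp a = exp b * exp (a - b)) by (rewrite <- exp_plus; f_equal; ring).
    assert (G3 : exp (- c) <= exp b).
    { destruct Hc as [Hc|Hc]; [left; apply exp_increasing, Hc | rewrite Hc; lra]. }
    assert (G4 := exp_ge_quadratic (a - b)).
    assert (G5 : exp (- c) * ((a - b) ^ 2 / 4) <= exp b * (exp (a - b) - 1)).
    { apply Rmult_le_compat; [left; apply exp_pos | generalize (pow2_ge_0 (a - b)); lra | lra | lra]. }
    assert (G6 : q * exp (- (INR k - 1) * a) <= q * exp (- (INR k - 1) * b))
      by (apply Rmult_le_compat_l; lra).
    lra. }
intros [x y]; specialize (H x y); unfold coords in H; lra.
Qed.

(** * The equation on a lattice *)


(** Kept apart from [lap] because it is the part that is monotone in [u], on which the fixed-point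
    argument rests. *)
Definition neighbours (u : Z -> Z -> R) (i j : Z) : R :=
  u (i + 1)%Z j + u (i - 1)%Z j + u i (j + 1)%Z + u i (j - 1)%Z.

Definition lap (h : R) (u : Z -> Z -> R) (i j : Z) : R :=
  (neighbours u i j - 4 * u i j) / h ^ 2.

Lemma neighbours_le (u v : Z -> Z -> R) (i j : Z) :
  (forall i j, u i j <= v i j) -> neighbours u i j <= neighbours v i j.
Proof. intros H; unfold neighbours; repeat apply Rplus_le_compat; apply H. Qed.

(** The left side increases with slope at least 4, so it takes the value [S] on [[- d, d]], where
    [d] is the distance from [S] to its value at 0. *)
Lemma monotone_scheme_solvable (F : R -> R) (c S : R) :
  0 <= c -> (forall s t, s <= t -> F s <= F t) -> continuity F ->
  exists t, 4 * t + c * F t = S.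
Proof.
intros Hc Hmono Hcont.
set (g := fun t => 4 * t + c * F t).
assert (Hg : forall s t, s <= t -> 4 * (t - s) <= g t - g s).
{ intros s t Hst; unfold g; assert (c * F s <= c * F t) by (apply Rmult_le_compat_l; auto); lra. }
set (d := Rabs (S - g 0)).
assert (Hd : 0 <= d) by apply Rabs_pos.
assert (Hd2 : - d <= S - g 0 <= d) by (apply Rabs_le_between, Rle_refl).
assert (H1 := Hg (- d) 0); assert (H2 := Hg 0 d).
destruct (IVT_gen g (- d) d S) as (t & _ & Ht).
- unfold g; intros t; apply continuity_pt_plus.
  + apply derivable_continuous_pt; reg.
  + apply continuity_pt_scal, Hcont.
- rewrite Rmin_left, Rmax_right by lra; lra.
- exists t; exact Ht.
Qed.

(* Perron/Knaster-Tarski: the supremum of the lattice subsolutions below [vp]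
   is a fixed point of the monotone one-point update. *)
Lemma lattice_solution (h : R) (F : Z -> Z -> R -> R) (vm vp : Z -> Z -> R) :
  0 < h ->
  (forall i j s t, s <= t -> F i j s <= F i j t) -> (forall i j, continuity (F i j)) ->
  (forall i j, vm i j <= vp i j) ->
  (forall i j, F i j (vm i j) <= lap h vm i j) ->
  (forall i j, lap h vp i j <= F i j (vp i j)) ->
  exists u, (forall i j, vm i j <= u i j <= vp i j) /\
    forall i j, lap h u i j = F i j (u i j).
Proof.
intros Hh Hmono Hcont Hle Hsub Hsup.
assert (Hh2 : 0 < h ^ 2) by (apply pow_lt, Hh).
(* Multiplied by [h ^ 2], the equation at a node reads [g i j (u i j) = neighbours u i j]; the
   one-point update is the inverse [G i j] of the increasing function [g i j], applied to
   [neighbours]. *)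
set (g := fun i j t => 4 * t + h ^ 2 * F i j t).
assert (Hg : forall i j s t, s <= t -> g i j s <= g i j t).
{ intros i j s t Hst; unfold g; generalize (Hmono i j s t Hst); nra. }
assert (Hg' : forall i j s t, g i j s <= g i j t -> s <= t).
{ intros i j s t H; apply Rnot_lt_le; intros Hts; unfold g in H.
  generalize (Hmono i j t s (Rlt_le _ _ Hts)); nra. }
assert (HT : forall i j S, exists t, g i j t = S).
{ intros i j S; apply monotone_scheme_solvable; [lra | apply Hmono | apply Hcont]. }
set (G := fun i j S => proj1_sig (constructive_indefinite_description _ (HT i j S))).
assert (HG : forall i j S, g i j (G i j S) = S).
{ intros i j S; exact (proj2_sig (constructive_indefinite_description _ (HT i j S))). }
clearbody G.
set (E := fun v : Z -> Z -> R =>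
  (forall i j, v i j <= vp i j) /\ (forall i j, g i j (v i j) <= neighbours v i j)).
assert (Hlap : forall v i j, lap h v i j * h ^ 2 = neighbours v i j - 4 * v i j).
{ intros v i j; unfold lap; field; lra. }
assert (Evm : E vm).
{ split; [exact Hle|]; intros i j; unfold g.
  generalize (Hlap vm i j) (Rmult_le_compat_r (h ^ 2) _ _ (Rlt_le _ _ Hh2) (Hsub i j)); lra. }
assert (Hl : forall i j, exists l, is_lub (fun t => exists v, E v /\ t = v i j) l).
{ intros i j; destruct (completeness (fun t => exists v, E v /\ t = v i j)) as [l Hl].
  - exists (vp i j); intros t (v & [Hv _] & ->); apply Hv.
  - exists (vm i j), vm; auto.
  - exists l; exact Hl. }
set (u := fun i j => proj1_sig (constructive_indefinite_description _ (Hl i j))).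
assert (Hu : forall i j, is_lub (fun t => exists v, E v /\ t = v i j) (u i j)).
{ intros i j; exact (proj2_sig (constructive_indefinite_description _ (Hl i j))). }
clearbody u.
assert (Hub : forall v, E v -> forall i j, v i j <= u i j).
{ intros v Hv i j; apply (Hu i j); exists v; auto. }
assert (Hup : forall i j, u i j <= vp i j).
{ intros i j; apply (Hu i j); intros t (v & [Hv _] & ->); apply Hv. }
set (Tu := fun i j => G i j (neighbours u i j)).
assert (HuT : forall i j, u i j <= Tu i j).
{ intros i j; apply (Hu i j); intros t (v & Hv & ->).
  apply (Hg' i j); unfold Tu; rewrite HG.
  eapply Rle_trans; [apply Hv | apply neighbours_le, Hub, Hv]. }
(* The update of the supremum is again a subsolution below [vp], hence at most [u]; with [HuT] this
   gives [u = Tu]. *)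
assert (ETu : E Tu).
{ split.
  - intros i j; apply (Hg' i j); unfold Tu; rewrite HG.
    eapply Rle_trans; [apply neighbours_le, Hup|]; unfold g.
    generalize (Hlap vp i j) (Rmult_le_compat_r (h ^ 2) _ _ (Rlt_le _ _ Hh2) (Hsup i j)); lra.
  - intros i j; unfold Tu at 1; rewrite HG; apply neighbours_le, HuT. }
exists u; split.
- intros i j; split; [apply Hub, Evm | apply Hup].
- intros i j.
  assert (Eq : u i j = Tu i j) by (apply Rle_antisym; [apply HuT | apply Hub, ETu]).
  assert (H : g i j (u i j) = neighbours u i j) by (rewrite Eq; apply HG).
  apply Rmult_eq_reg_r with (h ^ 2); [|lra].
  rewrite Hlap, <- H; unfold g; ring.
Qed.

(** * Interior gradient estimate on the lattice *)

Lemma argmin_interval (f : Z -> R) (a : Z) (n : nat) :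
  exists i, (a <= i <= a + Z.of_nat n)%Z /\
    forall i', (a <= i' <= a + Z.of_nat n)%Z -> f i <= f i'.
Proof.
induction n as [|n (i & Hi & Hmin)].
- exists a; split; [lia|]; intros i' H; replace i' with a by lia; lra.
- set (b := (a + Z.of_nat (S n))%Z).
  destruct (Rle_lt_dec (f i) (f b)) as [H|H]; [exists i | exists b]; split; try lia;
  intros i' Hi'; destruct (Z.eq_dec i' b) as [->|Hne]; try lra;
  assert (f i <= f i') by (apply Hmin; lia); lra.
Qed.

Lemma argmin_rectangle (f : Z -> Z -> R) (a b c d : Z) :
  (a <= b)%Z -> (c <= d)%Z ->
  exists i j, (a <= i <= b)%Z /\ (c <= j <= d)%Z /\
    forall i' j', (a <= i' <= b)%Z -> (c <= j' <= d)%Z -> f i j <= f i' j'.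
Proof.
intros Hab Hcd.
assert (HJ : forall i, exists j, (c <= j <= d)%Z /\
  forall j', (c <= j' <= d)%Z -> f i j <= f i j').
{ intros i; destruct (argmin_interval (f i) c (Z.to_nat (d - c))) as (j & Hj & Hmin).
  exists j; split; [lia|]; intros j' Hj'; apply Hmin; lia. }
set (J := fun i => proj1_sig (constructive_indefinite_description _ (HJ i))).
assert (HJ' : forall i, (c <= J i <= d)%Z /\
  forall j', (c <= j' <= d)%Z -> f i (J i) <= f i j').
{ intros i; exact (proj2_sig (constructive_indefinite_description _ (HJ i))). }
clearbody J.
destruct (argmin_interval (fun i => f i (J i)) a (Z.to_nat (b - a))) as (i & Hi & Hmin).
exists i, (J i); split; [lia | split; [apply HJ'|]].
intros i' j' Hi' Hj'.
apply Rle_trans with (f i' (J i')); [apply Hmin; lia | apply HJ', Hj'].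
Qed.

(* Discrete version of the half-cube comparison argument for Poisson's equation
   (Gilbarg-Trudinger, section 3.4): [v] is odd under the reflection
   [i -> 1 - i], and [psi] is the quadratic barrier, on which the discrete
   Laplacian is exact. *)
Lemma discrete_gradient_bound_le (h M N : R) (u : Z -> Z -> R) (m i0 j0 : Z) :
  0 < h -> (1 <= m)%Z ->
  (forall i j, (Z.abs (i - i0) <= m)%Z -> (Z.abs (j - j0) <= m)%Z ->
     Rabs (u i j) <= M /\ Rabs (lap h u i j) <= N) ->
  (u (i0 + 1)%Z j0 - u i0 j0) / h <= 4 * M / (IZR m * h) + (N + 1) * (IZR m * h).
Proof.
intros Hh Hm Hb.
assert (Hm' : 1 <= IZR m) by (apply (IZR_le 1), Hm).
set (d := IZR m * h).
assert (Hd : 0 < d) by (apply Rmult_lt_0_compat; lra).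
assert (HM : 0 <= M).
{ apply Rle_trans with (Rabs (u i0 j0)); [apply Rabs_pos | apply (Hb i0 j0); lia]. }
assert (HN : 0 <= N).
{ apply Rle_trans with (Rabs (lap h u i0 j0)); [apply Rabs_pos | apply (Hb i0 j0); lia]. }
(* The reflection is about the midpoint of the two nodes whose difference is to be bounded. *)
set (v := fun i j : Z => (u (i0 + i)%Z (j0 + j)%Z - u (i0 + (1 - i))%Z (j0 + j)%Z) / 2).
(* The first term is discretely harmonic and at least [M] on the sides [i = m] and [|j| = m]. The
   second has Laplacian [- (N + 1)], one below the least possible Laplacian [- N] of [v], which
   makes the comparison strict. *)
set (psi := fun i j : Z => M / d ^ 2 *
   ((IZR j * h) ^ 2 + IZR i * h * (2 * d - IZR i * h))
   + (N + 1) / 2 * (IZR i * h * (d - IZR i * h))).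
assert (HMd : 0 <= M / d ^ 2).
{ apply Rmult_le_pos; [exact HM | left; apply Rinv_0_lt_compat, pow_lt, Hd]. }
assert (Hv : forall i j, (1 <= i <= m)%Z -> (Z.abs j <= m)%Z -> v i j <= M).
{ intros i j Hi Hj; unfold v.
  destruct (Hb (i0 + i)%Z (j0 + j)%Z) as [A _]; [lia..|].
  destruct (Hb (i0 + (1 - i))%Z (j0 + j)%Z) as [B _]; [lia..|].
  apply Rabs_le_between in A; apply Rabs_le_between in B; lra. }
set (w := fun i j => psi i j - v i j).
destruct (argmin_rectangle w 1 m (- m) m) as (i & j & Hi & Hj & Hmin); [lia..|].
assert (Hw : 0 <= w i j).
{ apply Rnot_lt_le; intros Hneg.
  assert (Hih : 0 < IZR i * h <= d).
  { split; [apply Rmult_lt_0_compat; [apply (IZR_lt 0); lia | exact Hh]|].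
    apply Rmult_le_compat_r; [lra | apply IZR_le; lia]. }
  assert (Hbd : psi i j < M).
  { unfold w in Hneg; generalize (Hv i j Hi ltac:(lia)); lra. }
  assert (T1 : 0 <= IZR i * h * (d - IZR i * h)) by (apply Rmult_le_pos; lra).
  assert (T2 : 0 <= (N + 1) / 2 * (IZR i * h * (d - IZR i * h))) by (apply Rmult_le_pos; lra).
  assert (EM : M = M / d ^ 2 * d ^ 2) by (field; lra).
  assert (Him : i <> m).
  { intros ->; unfold psi in Hbd; fold d in Hbd, T2.
    assert (M / d ^ 2 * d ^ 2 <= M / d ^ 2 * ((IZR j * h) ^ 2 + d * (2 * d - d))).
    { apply Rmult_le_compat_l; [exact HMd | generalize (pow2_ge_0 (IZR j * h)); lra]. }
    lra. }
  assert (Hjm : (Z.abs j <> m)%Z).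
  { intros Ej; unfold psi in Hbd.
    assert (Ej2 : (IZR j * h) ^ 2 = d ^ 2).
    { unfold d; rewrite <- Ej, abs_IZR, !Rpow_mult_distr, pow2_abs; reflexivity. }
    rewrite Ej2 in Hbd.
    assert (M / d ^ 2 * d ^ 2 <= M / d ^ 2 * (d ^ 2 + IZR i * h * (2 * d - IZR i * h))).
    { apply Rmult_le_compat_l; [exact HMd | nra]. }
    lra. }
  assert (N1 : w i j <= w (i + 1)%Z j) by (apply Hmin; lia).
  assert (N2 : w i j <= w i (j + 1)%Z) by (apply Hmin; lia).
  assert (N3 : w i j <= w i (j - 1)%Z) by (apply Hmin; lia).
  (* In the first column the left neighbour lies outside the rectangle. There oddness gives
     [v 0 j = - v 1 j], so a negative [w 1 j] forces [v 1 j > 0] and [w 0 j > 0]. *)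
  assert (N4 : w i j <= w (i - 1)%Z j).
  { destruct (Z.eq_dec i 1) as [Ei|Ei]; [|apply Hmin; lia].
    subst i; simpl (1 - 1)%Z.
    assert (Ev : v 0%Z j = - v 1%Z j).
    { unfold v; simpl (1 - 0)%Z; simpl (1 - 1)%Z; field. }
    assert (P0 : 0 <= psi 0%Z j).
    { unfold psi; generalize (Rmult_le_pos _ _ HMd (pow2_ge_0 (IZR j * h))); lra. }
    assert (P1 : 0 <= psi 1%Z j).
    { unfold psi in T2 |- *.
      assert (0 <= M / d ^ 2 * ((IZR j * h) ^ 2 + 1 * h * (2 * d - 1 * h))).
      { apply Rmult_le_pos; [exact HMd | generalize (pow2_ge_0 (IZR j * h)); nra]. }
      lra. }
    unfold w in Hneg |- *; rewrite Ev; lra. }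
  assert (L1 : lap h psi i j = - (N + 1)).
  { unfold lap, neighbours, psi; rewrite !plus_IZR, !minus_IZR; field; lra. }
  assert (L2 : lap h v i j = (lap h u (i0 + i)%Z (j0 + j)%Z
                             - lap h u (i0 + (1 - i))%Z (j0 + j)%Z) / 2).
  { unfold lap, neighbours, v.
    replace (i0 + (i + 1))%Z with (i0 + i + 1)%Z by ring.
    replace (i0 + (i - 1))%Z with (i0 + i - 1)%Z by ring.
    replace (i0 + (1 - (i + 1)))%Z with (i0 + (1 - i) - 1)%Z by ring.
    replace (i0 + (1 - (i - 1)))%Z with (i0 + (1 - i) + 1)%Z by ring.
    replace (j0 + (j + 1))%Z with (j0 + j + 1)%Z by ring.
    replace (j0 + (j - 1))%Z with (j0 + j - 1)%Z by ring.
    field; lra. }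
  destruct (Hb (i0 + i)%Z (j0 + j)%Z) as [_ A]; [lia..|].
  destruct (Hb (i0 + (1 - i))%Z (j0 + j)%Z) as [_ B]; [lia..|].
  apply Rabs_le_between in A; apply Rabs_le_between in B.
  assert (L3 : lap h w i j = lap h psi i j - lap h v i j).
  { unfold lap, neighbours, w; field; lra. }
  assert (L4 : 0 <= lap h w i j).
  { unfold lap, neighbours; apply Rmult_le_pos; [lra|].
    left; apply Rinv_0_lt_compat, pow_lt, Hh. }
  lra. }
(* At this node [v] is half the difference sought, and [psi] is at most
   [h (2 M / d + (N + 1) d / 2)]. *)
assert (H1 : 0 <= w 1%Z 0%Z) by (apply Rle_trans with (w i j); [exact Hw | apply Hmin; lia]).
unfold w, v, psi in H1; simpl (1 - 1)%Z in H1; rewrite !Z.add_0_r in H1.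
assert (H2 : M / d ^ 2 * ((0 * h) ^ 2 + 1 * h * (2 * d - 1 * h)) <= 2 * M / d * h).
{ replace (2 * M / d * h) with (M / d ^ 2 * (2 * d * h)) by (field; lra).
  apply Rmult_le_compat_l; [exact HMd | nra]. }
assert (H3 : (N + 1) / 2 * (1 * h * (d - 1 * h)) <= (N + 1) / 2 * (d * h)).
{ apply Rmult_le_compat_l; [lra | nra]. }
apply Rmult_le_reg_r with h; [exact Hh|].
replace ((u (i0 + 1)%Z j0 - u i0 j0) / h * h) with (u (i0 + 1)%Z j0 - u i0 j0) by (field; lra).
replace ((4 * M / d + (N + 1) * d) * h)
  with (2 * (2 * M / d * h) + 2 * ((N + 1) / 2 * (d * h))) by (field; lra).
lra.
Qed.

Lemma discrete_gradient_bound (h M N : R) (u : Z -> Z -> R) (m i0 j0 : Z) :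
  0 < h -> (1 <= m)%Z ->
  (forall i j, (Z.abs (i - i0) <= m)%Z -> (Z.abs (j - j0) <= m)%Z ->
     Rabs (u i j) <= M /\ Rabs (lap h u i j) <= N) ->
  Rabs ((u (i0 + 1)%Z j0 - u i0 j0) / h) <= 4 * M / (IZR m * h) + (N + 1) * (IZR m * h).
Proof.
intros Hh Hm Hb.
assert (A := discrete_gradient_bound_le h M N u m i0 j0 Hh Hm Hb).
assert (B := discrete_gradient_bound_le h M N (fun i j => - u i j) m i0 j0 Hh Hm).
apply Rabs_le; split; [|exact A].
cbv beta in B.
replace ((- u (i0 + 1)%Z j0 - - u i0 j0) / h) with (- ((u (i0 + 1)%Z j0 - u i0 j0) / h)) in B
  by (field; lra).
apply Ropp_le_cancel; rewrite Ropp_involutive; apply B.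
intros i j Hi Hj; rewrite Rabs_Ropp.
replace (lap h (fun i j => - u i j) i j) with (- lap h u i j)
  by (unfold lap, neighbours; field; lra).
rewrite Rabs_Ropp; apply Hb; assumption.
Qed.

(** * Difference quotients of all orders *)


(** Dyadic meshes make the unit length a whole number of mesh steps on every grid. *)
Definition step (n : nat) : R := / 2 ^ n.

Lemma step_bounds (n : nat) : 0 < step n <= 1.
Proof.
assert (H : 1 <= 2 ^ n) by (apply pow_R1_Rle; lra); unfold step; split.
- apply Rinv_0_lt_compat; lra.
- rewrite <- Rinv_1; apply Rinv_le_contravar; lra.
Qed.

(* [F n i j] is the value at the point [(i 2^-n, j 2^-n)] of the n-th grid. *)
Definition grid_family : Type := nat -> Z -> Z -> R.

Definition locally_bounded (F : grid_family) : Prop :=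
  forall r, exists M, forall n i j,
    Rabs (IZR i * step n) <= r -> Rabs (IZR j * step n) <= r -> Rabs (F n i j) <= M.

Definition S1 (F : grid_family) : grid_family := fun n i j => F n (i + 1)%Z j.
Definition S2 (F : grid_family) : grid_family := fun n i j => F n i (j + 1)%Z.
Definition D1 (F : grid_family) : grid_family := fun n i j => (F n (i + 1)%Z j - F n i j) / step n.
Definition D2 (F : grid_family) : grid_family := fun n i j => (F n i (j + 1)%Z - F n i j) / step n.
(** Exchange of the axes, through which results proved for [D1] pass to [D2]. *)
Definition swap (F : grid_family) : grid_family := fun n i j => F n j i.
Definition fplus (F G : grid_family) : grid_family := fun n i j => F n i j + G n i j.
Definition fmult (F G : grid_family) : grid_family := fun n i j => F n i j * G n i j.
(** Constant on each grid but allowed to vary with the mesh, as the factors [eps n] in the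
    differences of [fexp] do. *)
Definition fconst (c : nat -> R) : grid_family := fun n _ _ => c n.
Definition Lap (F : grid_family) : grid_family := fun n => lap (step n) (F n).

(** Discrete counterpart of boundedness in [C^m] on compact sets, uniformly in the mesh. The
    recursion parallels that of [ex_diff_n], to which it is matched in the limit. *)
Fixpoint Cb (m : nat) (F : grid_family) : Prop :=
  locally_bounded F /\
  match m with
  | O => True
  | S m => Cb m (D1 F) /\ Cb m (D2 F)
  end.

Lemma grid_family_ext (F G : grid_family) : (forall n i j, F n i j = G n i j) -> F = G.
Proof.
intros H; do 3 (apply functional_extensionality; intro); apply H.
Qed.

Lemma Cb_ext (m : nat) (F G : grid_family) :
  Cb m F -> (forall n i j, F n i j = G n i j) -> Cb m G.
Proof. intros HF H; rewrite <- (grid_family_ext _ _ H); exact HF. Qed.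

Lemma Cb_locally_bounded (m : nat) (F : grid_family) : Cb m F -> locally_bounded F.
Proof. destruct m; intros H; apply H. Qed.

Lemma Cb_pred (m : nat) (F : grid_family) : Cb (S m) F -> Cb m F.
Proof.
revert F; induction m as [|m IH]; intros F (H & H1 & H2).
- split; trivial.
- split; [exact H | split; apply IH; assumption].
Qed.

Lemma locally_bounded_swap (F : grid_family) : locally_bounded F -> locally_bounded (swap F).
Proof. intros H r; destruct (H r) as [M HM]; exists M; intros; apply HM; assumption. Qed.

Lemma Cb_swap (m : nat) (F : grid_family) : Cb m F -> Cb m (swap F).
Proof.
revert F; induction m as [|m IH]; intros F H; split; try exact I.
- apply locally_bounded_swap, H.
- apply locally_bounded_swap, H.
- split; [exact (IH (D2 F) (proj2 (proj2 H))) | exact (IH (D1 F) (proj1 (proj2 H)))].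
Qed.

Lemma locally_bounded_S1 (F : grid_family) : locally_bounded F -> locally_bounded (S1 F).
Proof.
intros H r; destruct (H (r + 1)) as [M HM]; exists M; intros n i j Hi Hj.
destruct (step_bounds n) as [h0 h1]; apply HM; [|lra].
rewrite plus_IZR, Rmult_plus_distr_r, Rmult_1_l.
eapply Rle_trans; [apply Rabs_triang|]; rewrite (Rabs_right (step n)); lra.
Qed.

Lemma Cb_S1 (m : nat) (F : grid_family) : Cb m F -> Cb m (S1 F).
Proof.
revert F; induction m as [|m IH]; intros F H; split; try exact I.
- apply locally_bounded_S1, H.
- apply locally_bounded_S1, H.
- split; [exact (IH (D1 F) (proj1 (proj2 H))) | exact (IH (D2 F) (proj2 (proj2 H)))].
Qed.

Lemma Cb_S2 (m : nat) (F : grid_family) : Cb m F -> Cb m (S2 F).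
Proof. intros H; exact (Cb_swap m _ (Cb_S1 m _ (Cb_swap m F H))). Qed.

Lemma locally_bounded_fplus (F G : grid_family) :
  locally_bounded F -> locally_bounded G -> locally_bounded (fplus F G).
Proof.
intros HF HG r; destruct (HF r) as [M HM], (HG r) as [N HN]; exists (M + N).
intros n i j Hi Hj; eapply Rle_trans; [apply Rabs_triang|].
apply Rplus_le_compat; auto.
Qed.

Lemma Cb_fplus (m : nat) (F G : grid_family) : Cb m F -> Cb m G -> Cb m (fplus F G).
Proof.
revert F G; induction m as [|m IH]; intros F G HF HG; split; try exact I;
  try (apply locally_bounded_fplus; [apply HF | apply HG]).
destruct HF as (_ & F1 & F2), HG as (_ & G1 & G2).
split; [replace (D1 (fplus F G)) with (fplus (D1 F) (D1 G)) |
        replace (D2 (fplus F G)) with (fplus (D2 F) (D2 G))]; auto;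
apply grid_family_ext; intros n i j; unfold D1, D2, fplus; field;
generalize (step_bounds n); lra.
Qed.

Lemma locally_bounded_fmult (F G : grid_family) :
  locally_bounded F -> locally_bounded G -> locally_bounded (fmult F G).
Proof.
intros HF HG r; destruct (HF r) as [M HM], (HG r) as [N HN]; exists (M * N).
intros n i j Hi Hj; unfold fmult; rewrite Rabs_mult.
apply Rmult_le_compat; auto using Rabs_pos.
Qed.

(** Discrete Leibniz rule [D (F G) = D F * S G + F * D G]; the shift in it is the reason for [Cb_S1]
    and [Cb_S2]. *)
Lemma Cb_fmult (m : nat) (F G : grid_family) : Cb m F -> Cb m G -> Cb m (fmult F G).
Proof.
revert F G; induction m as [|m IH]; intros F G HF HG; split; try exact I;
  try (apply locally_bounded_fmult; [apply HF | apply HG]).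
assert (F0 := Cb_pred _ _ HF); assert (G0 := Cb_pred _ _ HG).
destruct HF as (_ & F1 & F2), HG as (_ & G1 & G2).
split.
- replace (D1 (fmult F G)) with (fplus (fmult (D1 F) (S1 G)) (fmult F (D1 G))).
  + apply Cb_fplus; apply IH; auto using Cb_S1.
  + apply grid_family_ext; intros n i j; unfold D1, S1, fplus, fmult; field.
    generalize (step_bounds n); lra.
- replace (D2 (fmult F G)) with (fplus (fmult (D2 F) (S2 G)) (fmult F (D2 G))).
  + apply Cb_fplus; apply IH; auto using Cb_S2.
  + apply grid_family_ext; intros n i j; unfold D2, S2, fplus, fmult; field.
    generalize (step_bounds n); lra.
Qed.

Lemma Cb_fconst (m : nat) (c : nat -> R) (M : R) :
  (forall n, Rabs (c n) <= M) -> Cb m (fconst c).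
Proof.
revert c M; induction m as [|m IH]; intros c M H; split; try exact I;
  try (intros r; exists M; intros; apply H).
replace (D1 (fconst c)) with (fconst (fun _ => 0)).
- replace (D2 (fconst c)) with (fconst (fun _ => 0)).
  + split; apply IH with (M := 0); intros _; rewrite Rabs_R0; lra.
  + apply grid_family_ext; intros n i j; unfold D2, fconst; field; generalize (step_bounds n); lra.
- apply grid_family_ext; intros n i j; unfold D1, fconst; field; generalize (step_bounds n); lra.
Qed.

Lemma Cb_constant (m : nat) (c : R) : Cb m (fconst (fun _ => c)).
Proof. apply Cb_fconst with (M := Rabs c); intros; lra. Qed.

Definition coordinate : grid_family := fun n i _ => IZR i * step n.

Lemma Cb_coordinate (m : nat) : Cb m coordinate.
Proof.
assert (H : locally_bounded coordinate) by (intros r; exists r; auto).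
destruct m; split; try exact I; try exact H.
replace (D1 coordinate) with (fconst (fun _ => 1)).
- replace (D2 coordinate) with (fconst (fun _ => 0)); [split; apply Cb_constant|].
  apply grid_family_ext; intros n i j; unfold D2, coordinate, fconst; field.
  generalize (step_bounds n); lra.
- apply grid_family_ext; intros n i j; unfold D1, coordinate, fconst; rewrite plus_IZR; field.
  generalize (step_bounds n); lra.
Qed.

(* [(exp (eps V) - 1) / eps]: unlike [exp V] itself, this class is closed under
   differences, since
   [D (fexp eps V) = (1 + eps fexp eps V) * fexp (eps * step) (D V)]. *)
Definition fexp (eps : nat -> R) (V : grid_family) : grid_family :=
  fun n i j => (exp (eps n * V n i j) - 1) / eps n.

Lemma Rabs_exp_minus_1 (x : R) : Rabs (exp x - 1) <= Rabs x * exp (Rabs x).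
Proof.
assert (H := exp_ineq1_le x); assert (H' := exp_ineq1_le (- x)); assert (P := exp_pos x).
rewrite exp_Ropp in H'; destruct (Rle_lt_dec 0 x) as [Hx|Hx].
- rewrite !Rabs_right by lra.
  assert (exp x * (1 + - x) <= exp x * / exp x) by (apply Rmult_le_compat_l; lra).
  rewrite Rinv_r in H0 by lra; lra.
- assert (exp x < 1) by (rewrite <- exp_0; apply exp_increasing, Hx).
  rewrite (Rabs_left x), Rabs_left by lra.
  assert (1 <= exp (- x)) by (generalize (exp_ineq1_le (- x)); lra); nra.
Qed.

(** From [|exp (e s) - 1| / e <= |s| exp (e |s|)] and [e <= 1] comes a bound that does not see [e].
    This matters because every differencing multiplies [eps n] by [step n]. *)
Lemma locally_bounded_fexp (eps : nat -> R) (V : grid_family) :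
  (forall n, 0 < eps n <= 1) -> locally_bounded V -> locally_bounded (fexp eps V).
Proof.
intros He HV r; destruct (HV r) as [M HM]; exists (M * exp M); intros n i j Hi Hj.
specialize (HM n i j Hi Hj); specialize (He n); unfold fexp.
set (s := V n i j) in *; set (e := eps n) in *.
assert (Hs := Rabs_pos s).
unfold Rdiv; rewrite Rabs_mult, Rabs_inv, (Rabs_right e) by lra.
apply Rmult_le_reg_r with e; [lra|].
rewrite Rmult_assoc, Rinv_l, Rmult_1_r by lra.
eapply Rle_trans; [apply Rabs_exp_minus_1|].
rewrite Rabs_mult, (Rabs_right e) by lra.
replace (M * exp M * e) with (e * M * exp M) by ring.
assert (e * Rabs s <= M) by nra.
apply Rmult_le_compat; [nra | left; apply exp_pos | nra |].
destruct (Req_dec (e * Rabs s) M) as [->|Hne]; [lra | left; apply exp_increasing; lra].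
Qed.

Lemma Cb_fexp (m : nat) (eps : nat -> R) (V : grid_family) :
  (forall n, 0 < eps n <= 1) -> Cb m V -> Cb m (fexp eps V).
Proof.
revert eps V; induction m as [|m IH]; intros eps V He HV; split; try exact I;
  try (apply locally_bounded_fexp; [exact He | apply HV]).
assert (V0 := Cb_pred _ _ HV); destruct HV as (_ & V1 & V2).
assert (He' : forall n, 0 < eps n * step n <= 1).
{ intros n; specialize (He n); generalize (step_bounds n); nra. }
assert (HC : Cb m (fplus (fconst (fun _ => 1)) (fmult (fconst eps) (fexp eps V)))).
{ apply Cb_fplus; [apply Cb_constant|]; apply Cb_fmult; [|apply IH; assumption].
  apply Cb_fconst with (M := 1); intros n; specialize (He n); rewrite Rabs_right; lra. }
assert (Key : forall n a b, (exp (eps n * b) - 1) / eps n - (exp (eps n * a) - 1) / eps n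
  = (1 + eps n * ((exp (eps n * a) - 1) / eps n)) *
    ((exp (eps n * step n * ((b - a) / step n)) - 1) / (eps n * step n)) * step n).
{ intros n a b; specialize (He n); assert (Hs := step_bounds n).
  replace (exp (eps n * b)) with (exp (eps n * a) * exp (eps n * step n * ((b - a) / step n))).
  - field; lra.
  - rewrite <- exp_plus; f_equal; field; lra. }
split.
- replace (D1 (fexp eps V)) with
    (fmult (fplus (fconst (fun _ => 1)) (fmult (fconst eps) (fexp eps V)))
       (fexp (fun n => eps n * step n) (D1 V))).
  + apply Cb_fmult; [exact HC | apply IH; assumption].
  + apply grid_family_ext; intros n i j; unfold fmult, fplus, fconst, fexp, D1.
    rewrite Key; field; specialize (He n); generalize (step_bounds n); lra.
- replace (D2 (fexp eps V)) with
    (fmult (fplus (fconst (fun _ => 1)) (fmult (fconst eps) (fexp eps V)))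
       (fexp (fun n => eps n * step n) (D2 V))).
  + apply Cb_fmult; [exact HC | apply IH; assumption].
  + apply grid_family_ext; intros n i j; unfold fmult, fplus, fconst, fexp, D2.
    rewrite Key; field; specialize (He n); generalize (step_bounds n); lra.
Qed.

Definition grid_point (n : nat) (i j : Z) : C := (IZR i * step n, IZR j * step n).

Lemma Cb_polynomial (phi : C -> C) (m : nat) :
  is_polynomial phi ->
  Cb m (fun n i j => Re (phi (grid_point n i j))) /\
  Cb m (fun n i j => Im (phi (grid_point n i j))).
Proof.
revert phi; apply (polynomial_horner_ind (fun phi => Cb _ (fun n i j => Re (phi _)) /\ _)).
- intros c; split; apply Cb_constant.
- intros c f [HR HI].
  assert (HX := Cb_coordinate m); assert (HY := Cb_swap m _ HX).
  assert (HYI := Cb_fmult m _ _ (Cb_constant m (-1)) (Cb_fmult m _ _ HY HI)).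
  assert (A := Cb_fplus m _ _ (Cb_constant m (Re c))
                 (Cb_fplus m _ _ (Cb_fmult m _ _ HX HR) HYI)).
  assert (B := Cb_fplus m _ _ (Cb_constant m (Im c))
                 (Cb_fplus m _ _ (Cb_fmult m _ _ HX HI) (Cb_fmult m _ _ HY HR))).
  split; [apply (Cb_ext m _ _ A) | apply (Cb_ext m _ _ B)]; intros n i j;
  unfold fplus, fmult, fconst, swap, coordinate, grid_point, Re, Im; simpl; ring.
Qed.

Lemma Cb_polynomial_norm (phi : C -> C) (m : nat) :
  is_polynomial phi -> Cb m (fun n i j => Cmod (phi (grid_point n i j)) ^ 2).
Proof.
intros H; destruct (Cb_polynomial phi m H) as [HR HI].
apply (Cb_ext m _ _ (Cb_fplus m _ _ (Cb_fmult m _ _ HR HR) (Cb_fmult m _ _ HI HI))).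
intros n i j; rewrite Cmod2_alt; unfold fplus, fmult; ring.
Qed.

(** * Bootstrapping regularity on the grids *)

Lemma Lap_swap (F : grid_family) : Lap (swap F) = swap (Lap F).
Proof.
apply grid_family_ext; intros n i j; unfold Lap, swap, lap, neighbours.
field; generalize (step_bounds n); lra.
Qed.

Lemma locally_bounded_D1 (U : grid_family) :
  locally_bounded U -> locally_bounded (Lap U) -> locally_bounded (D1 U).
Proof.
intros HU HL r; destruct (HU (r + 1)) as [M HM], (HL (r + 1)) as [N HN].
exists (4 * M + (N + 1)); intros n i j Hi Hj.
assert (Hs := step_bounds n).
(* This many mesh steps make up length 1, so the gradient estimate is used on a square of fixed
   size; the price is the passage from [r] to [r + 1]. *)
set (m := (2 ^ Z.of_nat n)%Z).
assert (Hm : IZR m * step n = 1).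
{ unfold m, step; rewrite <- pow_IZR; field; apply pow_nonzero; lra. }
assert (Hm1 : (1 <= m)%Z) by (unfold m; generalize (Z.pow_pos_nonneg 2 (Z.of_nat n)); lia).
assert (Hin : forall a b, (Z.abs (a - b) <= m)%Z -> Rabs (IZR b * step n) <= r ->
  Rabs (IZR a * step n) <= r + 1).
{ intros a b Hab Hb.
  replace (IZR a * step n) with (IZR b * step n + IZR (a - b) * step n)
    by (rewrite minus_IZR; ring).
  eapply Rle_trans; [apply Rabs_triang|]; apply Rplus_le_compat; [exact Hb|].
  rewrite <- Hm, Rabs_mult, (Rabs_right (step n)) by lra.
  apply Rmult_le_compat_r; [lra|]; rewrite <- abs_IZR; apply IZR_le, Hab. }
assert (H := discrete_gradient_bound (step n) M N (U n) m i j (proj1 Hs) Hm1).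
rewrite Hm in H; unfold D1.
replace (4 * M + (N + 1)) with (4 * M / 1 + (N + 1) * 1) by field.
apply H; intros a b Ha Hb; split; [apply HM | apply HN];
  [apply (Hin a i) | apply (Hin b j) | apply (Hin a i) | apply (Hin b j)]; assumption.
Qed.

(** [D1] and [D2] commute with [Lap], so the gradient estimate applies in turn to the difference
    quotients of [U]. A gain of one order is enough for the bootstrap. *)
Lemma Cb_gain (m : nat) (U : grid_family) : locally_bounded U -> Cb m (Lap U) -> Cb (S m) U.
Proof.
revert U; induction m as [|m IH]; intros U HU HL;
assert (B1 : locally_bounded (D1 U))
  by (apply locally_bounded_D1; [exact HU | exact (Cb_locally_bounded _ _ HL)]);
assert (B2 : locally_bounded (D2 U))
  by (apply (locally_bounded_swap (D1 (swap U))), locally_bounded_D1;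
      [apply locally_bounded_swap, HU |
       rewrite Lap_swap; apply locally_bounded_swap; exact (Cb_locally_bounded _ _ HL)]).
- split; [exact HU | split; split; trivial].
- destruct HL as (_ & L1 & L2).
  split; [exact HU|]; split; apply IH; trivial.
  + replace (Lap (D1 U)) with (D1 (Lap U)); [exact L1|].
    apply grid_family_ext; intros n i j; unfold D1, Lap, lap, neighbours.
    replace (i + 1 - 1)%Z with (i - 1 + 1)%Z by ring.
    field; generalize (step_bounds n); lra.
  + replace (Lap (D2 U)) with (D2 (Lap U)); [exact L2|].
    apply grid_family_ext; intros n i j; unfold D2, Lap, lap, neighbours.
    replace (j + 1 - 1)%Z with (j - 1 + 1)%Z by ring.
    field; generalize (step_bounds n); lra.
Qed.

Lemma Cb_solution (k : nat) (Q U : grid_family) :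
  (forall m, Cb m Q) -> locally_bounded U ->
  (forall n i j, Lap U n i j = rhs k (Q n i j) (U n i j)) -> forall m, Cb m U.
Proof.
intros HQ HU HE; induction m as [|m IH]; [split; trivial|].
apply Cb_gain; [exact HU|].
(* With [eps = 1] the exponential is [exp V = 1 + fexp 1 V], so the right side of the equation
   inherits [Cb m] from [U]. *)
assert (He : forall n : nat, 0 < 1 <= 1) by (intros; lra).
assert (A := Cb_fexp m _ _ He IH).
assert (B := Cb_fexp m _ _ He (Cb_fmult m _ _ (Cb_constant m (- (INR k - 1))) IH)).
assert (H := Cb_fplus m _ _ (Cb_fplus m _ _ (Cb_constant m 1) A)
  (Cb_fmult m _ _ (Cb_fmult m _ _ (Cb_constant m (-1)) (HQ m))
     (Cb_fplus m _ _ (Cb_constant m 1) B))).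
apply (Cb_ext m _ _ H); intros n i j.
rewrite HE; unfold fplus, fmult, fconst, fexp, rhs; rewrite !Rmult_1_l; field.
Qed.

(** * The limit of vanishing mesh *)


Definition cell (n : nat) (x : R) : Z := Int_part (x / step n).

Lemma cell_bounds (n : nat) (x : R) : Rabs (IZR (cell n x) * step n - x) <= step n.
Proof.
destruct (base_Int_part (x / step n)) as [H1 H2]; assert (Hs := step_bounds n).
fold (cell n x) in H1, H2.
replace (IZR (cell n x) * step n - x) with ((IZR (cell n x) - x / step n) * step n)
  by (field; lra).
rewrite Rabs_mult, (Rabs_right (step n)) by lra.
apply Rle_trans with (1 * step n); [|lra].
apply Rmult_le_compat_r; [lra | apply Rabs_le; lra].
Qed.

Lemma cell_in_box (n : nat) (x r : R) : Rabs x <= r -> Rabs (IZR (cell n x) * step n) <= r + 1.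
Proof.
intros Hx; replace (IZR (cell n x) * step n) with (x + (IZR (cell n x) * step n - x)) by ring.
eapply Rle_trans; [apply Rabs_triang|].
generalize (cell_bounds n x) (step_bounds n); lra.
Qed.

Lemma step_lim : filterlim step UF (locally 0).
Proof.
assert (H : is_lim_seq step 0).
{ apply (is_lim_seq_ext (fun n => (/ 2) ^ n)).
  - intros n; unfold step; apply pow_inv.
  - apply is_lim_seq_geom; rewrite Rabs_right; lra. }
intros P HP; apply free_ultrafilter_eventually, H, HP.
Qed.

Lemma filterlim_squeeze0 (s : nat -> R) (l M : R) :
  (forall n, Rabs (s n - l) <= M * step n) -> filterlim s UF (locally l).
Proof.
intros H; apply filterlim_locally; intros eps.
assert (HM : 0 <= M).
{ specialize (H O); generalize (Rabs_pos (s O - l)) (step_bounds O); nra. }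
assert (He : 0 < eps / (M + 1)) by (apply Rdiv_lt_0_compat; [apply cond_pos | lra]).
generalize (proj1 (filterlim_locally _ _) step_lim (mkposreal _ He)).
apply filter_imp; intros n Hn.
change (Rabs (step n - 0) < eps / (M + 1)) in Hn; change (Rabs (s n - l) < eps).
assert (Hs := step_bounds n).
rewrite Rminus_0_r, Rabs_right in Hn by lra.
eapply Rle_lt_trans; [apply H|].
apply Rle_lt_trans with ((M + 1) * step n); [lra|].
apply Rmult_lt_compat_l with (r := M + 1) in Hn; [|lra].
replace ((M + 1) * (eps / (M + 1))) with (pos eps) in Hn by (field; lra); exact Hn.
Qed.

Lemma cell_lim (x : R) : filterlim (fun n => IZR (cell n x) * step n) UF (locally x).
Proof. apply filterlim_squeeze0 with (M := 1); intros n; rewrite Rmult_1_l; apply cell_bounds. Qed.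

Lemma lim_plus (u v : nat -> R) (a b : R) :
  filterlim u UF (locally a) -> filterlim v UF (locally b) ->
  filterlim (fun n => u n + v n) UF (locally (a + b)).
Proof.
apply (filterlim_2d UF Rplus), continuity_2d_pt_plus;
[apply continuity_2d_pt_id1 | apply continuity_2d_pt_id2].
Qed.

Lemma lim_minus (u v : nat -> R) (a b : R) :
  filterlim u UF (locally a) -> filterlim v UF (locally b) ->
  filterlim (fun n => u n - v n) UF (locally (a - b)).
Proof.
apply (filterlim_2d UF Rminus), continuity_2d_pt_minus;
[apply continuity_2d_pt_id1 | apply continuity_2d_pt_id2].
Qed.

Lemma lim_mult (u v : nat -> R) (a b : R) :
  filterlim u UF (locally a) -> filterlim v UF (locally b) ->
  filterlim (fun n => u n * v n) UF (locally (a * b)).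
Proof.
apply (filterlim_2d UF Rmult), continuity_2d_pt_mult;
[apply continuity_2d_pt_id1 | apply continuity_2d_pt_id2].
Qed.

Lemma lim_comp (g : R -> R) (u : nat -> R) (a : R) :
  continuity_pt g a -> filterlim u UF (locally a) ->
  filterlim (fun n => g (u n)) UF (locally (g a)).
Proof.
intros Hg Hu; apply (filterlim_comp _ _ _ u g UF (locally a)); [exact Hu|].
apply continuity_pt_filterlim, Hg.
Qed.

Lemma lim_le (u v : nat -> R) (a b : R) :
  (forall n, u n <= v n) ->
  filterlim u UF (locally a) -> filterlim v UF (locally b) -> a <= b.
Proof.
intros H Hu Hv; apply (filterlim_le (F := UF) u v a b); [|exact Hu | exact Hv].
apply filter_forall, H.
Qed.

(** One ultrafilter serves all points and all families, so the limits of [F] and of its difference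
    quotients of every order are compatible without any extraction of subsequences. *)
Definition flim (F : grid_family) (x y : R) : R := ulim (fun n => F n (cell n x) (cell n y)).

Lemma flim_spec (F : grid_family) (x y : R) :
  locally_bounded F ->
  filterlim (fun n => F n (cell n x) (cell n y)) UF (locally (flim F x y)).
Proof.
intros HF; destruct (HF (Rmax (Rabs x) (Rabs y) + 1)) as [M HM].
apply ulim_spec with (M := M); intros n.
apply HM; apply cell_in_box; [apply Rmax_l | apply Rmax_r].
Qed.

Lemma lattice_lipschitz (F : grid_family) (n : nat) (r M : R) (i j : Z) (p : nat) :
  (forall i j, Rabs (IZR i * step n) <= r -> Rabs (IZR j * step n) <= r ->
     Rabs (D1 F n i j) <= M) ->
  Rabs (IZR i * step n) <= r -> Rabs (IZR (i + Z.of_nat p) * step n) <= r ->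
  Rabs (IZR j * step n) <= r ->
  Rabs (F n (i + Z.of_nat p)%Z j - F n i j) <= M * (INR p * step n).
Proof.
intros HD Hi Hip Hj; assert (Hs := step_bounds n).
induction p as [|p IH].
- rewrite Z.add_0_r, Rminus_eq_0, Rabs_R0; simpl; lra.
- assert (Hp : Rabs (IZR (i + Z.of_nat p) * step n) <= r).
  { apply Rabs_le_between in Hi; apply Rabs_le_between in Hip.
    assert (IZR i <= IZR (i + Z.of_nat p) <= IZR (i + Z.of_nat (S p)))
      by (split; apply IZR_le; lia).
    apply Rabs_le; split; nra. }
  specialize (IH Hp); specialize (HD _ j Hp Hj).
  replace (i + Z.of_nat (S p))%Z with (i + Z.of_nat p + 1)%Z by lia.
  rewrite S_INR.
  replace (F n (i + Z.of_nat p + 1)%Z j - F n i j) with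
    (D1 F n (i + Z.of_nat p)%Z j * step n + (F n (i + Z.of_nat p)%Z j - F n i j))
    by (unfold D1; field; lra).
  eapply Rle_trans; [apply Rabs_triang|].
  rewrite Rabs_mult, (Rabs_right (step n)) by lra; nra.
Qed.

(** Each step adds [step n] times the variation of [D1 F], controlled by [lattice_lipschitz]. The
    constant [M] instead of [M / 2] leaves room for the induction: [p ^ 2 + p <= (p + 1) ^ 2]. *)
Lemma lattice_taylor_pos (F : grid_family) (n : nat) (r M : R) (i j : Z) (p : nat) :
  (forall i j, Rabs (IZR i * step n) <= r -> Rabs (IZR j * step n) <= r ->
     Rabs (D1 (D1 F) n i j) <= M) ->
  Rabs (IZR i * step n) <= r -> Rabs (IZR (i + Z.of_nat p) * step n) <= r ->
  Rabs (IZR j * step n) <= r ->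
  Rabs (F n (i + Z.of_nat p)%Z j - F n i j - INR p * step n * D1 F n i j)
    <= M * (INR p * step n) ^ 2.
Proof.
intros HD Hi Hip Hj; assert (Hs := step_bounds n).
assert (HM : 0 <= M) by (eapply Rle_trans; [apply Rabs_pos | exact (HD i j Hi Hj)]).
induction p as [|p IH].
- simpl; rewrite Z.add_0_r, Rminus_eq_0, Rmult_0_l, Rmult_0_l, Rminus_eq_0, Rabs_R0; lra.
- assert (Hp : Rabs (IZR (i + Z.of_nat p) * step n) <= r).
  { apply Rabs_le_between in Hi; apply Rabs_le_between in Hip.
    assert (IZR i <= IZR (i + Z.of_nat p) <= IZR (i + Z.of_nat (S p)))
      by (split; apply IZR_le; lia).
    apply Rabs_le; split; nra. }
  specialize (IH Hp).
  assert (L := lattice_lipschitz (D1 F) n r M i j p HD Hi Hp Hj).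
  replace (i + Z.of_nat (S p))%Z with (i + Z.of_nat p + 1)%Z by lia.
  rewrite S_INR.
  replace (F n (i + Z.of_nat p + 1)%Z j - F n i j - (INR p + 1) * step n * D1 F n i j) with
    ((D1 F n (i + Z.of_nat p)%Z j - D1 F n i j) * step n
     + (F n (i + Z.of_nat p)%Z j - F n i j - INR p * step n * D1 F n i j))
    by (unfold D1; field; lra).
  eapply Rle_trans; [apply Rabs_triang|].
  rewrite Rabs_mult, (Rabs_right (step n)) by lra.
  assert (Hp0 := pos_INR p).
  assert (L2 := Rmult_le_compat_r (step n) _ _ ltac:(lra) L).
  assert (0 <= M * (INR p * step n * step n)) by (repeat apply Rmult_le_pos; lra).
  assert (0 <= M * (step n * step n)) by (repeat apply Rmult_le_pos; lra).
  nra.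
Qed.

(** For [i' < i] the expansion is taken at [i'] and the slope is then moved to [i], which costs a
    second [M * t ^ 2]; hence the factor 2. *)
Lemma lattice_taylor (F : grid_family) (n : nat) (r M : R) (i i' j : Z) :
  (forall i j, Rabs (IZR i * step n) <= r -> Rabs (IZR j * step n) <= r ->
     Rabs (D1 (D1 F) n i j) <= M) ->
  Rabs (IZR i * step n) <= r -> Rabs (IZR i' * step n) <= r ->
  Rabs (IZR j * step n) <= r ->
  Rabs (F n i' j - F n i j - (IZR i' * step n - IZR i * step n) * D1 F n i j)
    <= 2 * M * (IZR i' * step n - IZR i * step n) ^ 2.
Proof.
intros HD Hi Hi' Hj; assert (Hs := step_bounds n).
assert (HM : 0 <= M) by (eapply Rle_trans; [apply Rabs_pos | exact (HD i j Hi Hj)]).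
destruct (Z_le_gt_dec i i') as [Hle|Hgt].
- assert (E : i' = (i + Z.of_nat (Z.to_nat (i' - i)))%Z) by lia.
  set (p := Z.to_nat (i' - i)) in E.
  assert (E2 : IZR i' * step n - IZR i * step n = INR p * step n)
    by (rewrite E, plus_IZR, <- INR_IZR_INZ; ring).
  rewrite E2; rewrite E in Hi' |- *.
  generalize (lattice_taylor_pos F n r M i j p HD Hi Hi' Hj).
  assert (0 <= M * (INR p * step n) ^ 2) by (apply Rmult_le_pos; [lra | apply pow2_ge_0]); lra.
- assert (E : i = (i' + Z.of_nat (Z.to_nat (i - i')))%Z) by lia.
  set (p := Z.to_nat (i - i')) in E.
  assert (E2 : IZR i' * step n - IZR i * step n = - (INR p * step n))
    by (rewrite E, plus_IZR, <- INR_IZR_INZ; ring).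
  rewrite E2; rewrite E in Hi.
  assert (A := lattice_taylor_pos F n r M i' j p HD Hi' Hi Hj).
  assert (B := lattice_lipschitz (D1 F) n r M i' j p HD Hi' Hi Hj).
  rewrite <- E in A, B.
  assert (Hp : 0 <= INR p * step n) by (apply Rmult_le_pos; [apply pos_INR | lra]).
  set (t := INR p * step n) in *.
  replace (F n i' j - F n i j - - t * D1 F n i j) with
    (- (F n i j - F n i' j - t * D1 F n i' j) + t * (D1 F n i j - D1 F n i' j)) by ring.
  eapply Rle_trans; [apply Rabs_triang|]; rewrite Rabs_Ropp, Rabs_mult, (Rabs_right t) by lra.
  assert (B2 := Rmult_le_compat_l t _ _ Hp B); lra.
Qed.

(** The lattice expansion has a constant independent of the mesh, so it survives the ultralimit; its
    quadratic remainder makes [flim (D1 F)] the derivative of [flim F]. *)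
Lemma flim_taylor (F : grid_family) (r : R) :
  Cb 2 F ->
  exists M, 0 <= M /\ forall x x' y, Rabs x <= r -> Rabs x' <= r -> Rabs y <= r ->
    Rabs (flim F x' y - flim F x y - (x' - x) * flim (D1 F) x y) <= M * (x' - x) ^ 2.
Proof.
intros HF; destruct HF as (F0 & F1 & _).
assert (F1' := Cb_locally_bounded _ _ F1).
destruct F1 as (_ & (F11 & _) & _).
destruct (F11 (r + 1)) as [M HM]; exists (2 * Rabs M).
split; [generalize (Rabs_pos M); lra|]; intros x x' y Hx Hx' Hy.
apply (lim_le
  (fun n => Rabs (F n (cell n x') (cell n y) - F n (cell n x) (cell n y)
     - (IZR (cell n x') * step n - IZR (cell n x) * step n) * D1 F n (cell n x) (cell n y)))
  (fun n => 2 * Rabs M *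
     ((IZR (cell n x') * step n - IZR (cell n x) * step n) ^ 2))).
- intros n; apply (lattice_taylor F n (r + 1)); try (apply cell_in_box; assumption).
  intros i j Hi Hj; eapply Rle_trans; [apply HM; assumption | apply Rle_abs].
- apply (lim_comp Rabs); [apply Rcontinuity_abs|].
  apply lim_minus; [apply lim_minus; apply flim_spec, F0|].
  apply lim_mult; [apply lim_minus; apply cell_lim | apply flim_spec, F1'].
- apply lim_mult; [apply filterlim_const|].
  apply (lim_comp (fun t => t ^ 2)); [apply derivable_continuous_pt; reg|].
  apply lim_minus; apply cell_lim.
Qed.

Lemma flim_is_derive (F : grid_family) (x y : R) :
  Cb 2 F -> is_derive (fun t => flim F t y) x (flim (D1 F) x y).
Proof.
intros HF; apply is_derive_Reals; intros eps Heps.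
destruct (flim_taylor F (Rabs x + Rabs y + 1) HF) as (M & HM & H).
assert (Hd : 0 < Rmin 1 (eps / (M + 1))).
{ apply Rmin_glb_lt; [lra | apply Rdiv_lt_0_compat; lra]. }
exists (mkposreal _ Hd); simpl; intros h Hh0 Hh.
assert (Hx := Rabs_pos x); assert (Hy := Rabs_pos y).
assert (Hh1 : Rabs h < 1) by (eapply Rlt_le_trans; [exact Hh | apply Rmin_l]).
assert (Hh2 : Rabs h < eps / (M + 1)) by (eapply Rlt_le_trans; [exact Hh | apply Rmin_r]).
assert (T := H x (x + h) y ltac:(lra)
  ltac:(generalize (Rabs_triang x h); lra) ltac:(lra)).
replace (x + h - x) with h in T by ring.
replace ((flim F (x + h) y - flim F x y) / h - flim (D1 F) x y) with
  ((flim F (x + h) y - flim F x y - h * flim (D1 F) x y) * / h) by (field; exact Hh0).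
assert (Hh3 : 0 < Rabs h) by (apply Rabs_pos_lt, Hh0).
rewrite Rabs_mult, Rabs_inv.
apply Rle_lt_trans with (M * Rabs h).
- apply Rmult_le_reg_r with (Rabs h); [exact Hh3|].
  rewrite Rmult_assoc, Rinv_l, Rmult_1_r by lra.
  rewrite <- pow2_abs in T; lra.
- apply Rle_lt_trans with ((M + 1) * Rabs h); [lra|].
  apply Rmult_lt_compat_l with (r := M + 1) in Hh2; [|lra].
  replace ((M + 1) * (eps / (M + 1))) with eps in Hh2 by (field; lra); exact Hh2.
Qed.

Lemma flim_lipschitz (F : grid_family) (r : R) :
  Cb 1 F ->
  exists M, 0 <= M /\ forall x x' y, Rabs x <= r -> Rabs x' <= r -> Rabs y <= r ->
    Rabs (flim F x' y - flim F x y) <= M * Rabs (x' - x).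
Proof.
intros (F0 & (F1 & _) & _).
destruct (F1 (r + 1)) as [M HM]; exists (Rabs M).
split; [apply Rabs_pos|].
assert (W : forall x x' y, x <= x' -> Rabs x <= r -> Rabs x' <= r -> Rabs y <= r ->
  Rabs (flim F x' y - flim F x y) <= Rabs M * (x' - x)).
{ intros x x' y Hxx Hx Hx' Hy.
  apply (lim_le
    (fun n => Rabs (F n (cell n x') (cell n y) - F n (cell n x) (cell n y)))
    (fun n => Rabs M * (IZR (cell n x') * step n - IZR (cell n x) * step n))).
  - intros n; assert (Hs := step_bounds n).
    assert (Hc : (cell n x <= cell n x')%Z).
    { unfold cell; apply Z.lt_succ_r, lt_IZR; unfold Z.succ; rewrite plus_IZR.
      assert (x / step n <= x' / step n).
      { apply Rmult_le_compat_r; [left; apply Rinv_0_lt_compat; lra | exact Hxx]. }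
      generalize (base_Int_part (x / step n)) (base_Int_part (x' / step n)); lra. }
    assert (E : cell n x' = (cell n x + Z.of_nat (Z.to_nat (cell n x' - cell n x)))%Z) by lia.
    set (p := Z.to_nat (cell n x' - cell n x)) in E.
    replace (IZR (cell n x') * step n - IZR (cell n x) * step n) with (INR p * step n)
      by (rewrite E, plus_IZR, <- INR_IZR_INZ; ring).
    assert (B := cell_in_box n x' r Hx'); rewrite E in B |- *.
    apply (lattice_lipschitz F n (r + 1)); trivial; try (apply cell_in_box; assumption).
    intros i j Hi Hj; eapply Rle_trans; [apply HM; assumption | apply Rle_abs].
  - apply (lim_comp Rabs); [apply Rcontinuity_abs|].
    apply lim_minus; apply flim_spec, F0.
  - apply lim_mult; [apply filterlim_const | apply lim_minus; apply cell_lim]. }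
intros x x' y Hx Hx' Hy; destruct (Rle_dec x x') as [H|H].
- rewrite (Rabs_right (x' - x)) by lra; apply W; assumption.
- rewrite Rabs_minus_sym, (Rabs_minus_sym x' x), (Rabs_right (x - x')) by lra.
  apply W; lra.
Qed.

Lemma flim_continuous (F : grid_family) (x y : R) : Cb 1 F -> continuity_2d_pt (flim F) x y.
Proof.
intros HF eps.
set (r := Rabs x + Rabs y + 1).
destruct (flim_lipschitz F r HF) as (M & HM & H).
destruct (flim_lipschitz (swap F) r (Cb_swap 1 F HF)) as (N & HN & H').
assert (He := cond_pos eps).
assert (Hd : 0 < Rmin 1 (eps / (M + N + 1))).
{ apply Rmin_glb_lt; [lra | apply Rdiv_lt_0_compat; lra]. }
exists (mkposreal _ Hd); simpl; intros u v Hu Hv.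
assert (Hx := Rabs_pos x); assert (Hy := Rabs_pos y).
assert (L := Rmin_l 1 (eps / (M + N + 1))); assert (L' := Rmin_r 1 (eps / (M + N + 1))).
assert (Hu' : Rabs u <= r).
{ unfold r; generalize (Rabs_triang (u - x) x); replace (u - x + x) with u by ring; lra. }
assert (Hv' : Rabs v <= r).
{ unfold r; generalize (Rabs_triang (v - y) y); replace (v - y + y) with v by ring; lra. }
assert (A := H x u v ltac:(unfold r; lra) Hu' Hv').
assert (B := H' y v x ltac:(unfold r; lra) Hv' ltac:(unfold r; lra)).
change (flim (swap F) v x) with (flim F x v) in B.
change (flim (swap F) y x) with (flim F x y) in B.
replace (flim F u v - flim F x y) with
  ((flim F u v - flim F x v) + (flim F x v - flim F x y)) by ring.
eapply Rle_lt_trans; [apply Rabs_triang|].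
set (d := eps / (M + N + 1)) in *.
assert (Ed : (M + N + 1) * d = eps) by (unfold d; field; lra).
assert (M * Rabs (u - x) <= M * d) by (apply Rmult_le_compat_l; lra).
assert (N * Rabs (v - y) <= N * d) by (apply Rmult_le_compat_l; lra).
assert (0 < d) by (eapply Rlt_le_trans; [exact Hd | exact L']).
lra.
Qed.

Lemma Derive_flim_1 (F : grid_family) (x y : R) :
  Cb 2 F -> Derive (fun t => flim F t y) x = flim (D1 F) x y.
Proof. intros HF; apply is_derive_unique, flim_is_derive, HF. Qed.

Lemma flim_is_derive_2 (F : grid_family) (x y : R) :
  Cb 2 F -> is_derive (fun t => flim F x t) y (flim (D2 F) x y).
Proof. intros HF; exact (flim_is_derive (swap F) y x (Cb_swap 2 F HF)). Qed.

Lemma Derive_flim_2 (F : grid_family) (x y : R) :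
  Cb 2 F -> Derive (fun t => flim F x t) y = flim (D2 F) x y.
Proof. intros HF; apply is_derive_unique, flim_is_derive_2, HF. Qed.

(** The functions [flim F] with [F] in every [Cb m] form a class closed under both partial
    derivatives, and [ex_diff_n] recurses along exactly these. *)
Lemma flim_smooth (F : grid_family) (n : nat) (x y : R) :
  (forall m, Cb m F) -> ex_diff_n (flim F) n x y.
Proof.
revert F x y; induction n as [|n IH]; intros F x y HF;
  (split; [apply flim_continuous, HF|]); [exact I|].
split; [eexists; apply flim_is_derive, HF|].
split; [eexists; apply flim_is_derive_2, HF|].
split.
- replace (fun u v => Derive (fun z => flim F z v) u) with (flim (D1 F)).
  + apply IH; intros m; apply (HF (S m)).
  + do 2 (apply functional_extensionality; intro); symmetry; apply Derive_flim_1, HF.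
- replace (fun u v => Derive (fun z => flim F u z) v) with (flim (D2 F)).
  + apply IH; intros m; apply (HF (S m)).
  + do 2 (apply functional_extensionality; intro); symmetry; apply Derive_flim_2, HF.
Qed.

(** The centred lattice Laplacian is a sum of second forward differences taken one node back. This
    displacement disappears in the limit, since its effect is [step n] times a bounded difference
    quotient. *)
Lemma backward_shift_lim (G : grid_family) (x y : R) :
  Cb 1 G ->
  filterlim (fun n => G n (cell n x - 1)%Z (cell n y)) UF (locally (flim G x y)).
Proof.
intros (G0 & (G1 & _) & _).
set (r := Rabs x + Rabs y).
(* [cell_in_box] costs 1, and the shifted node at most one more mesh step. *)
destruct (G1 (r + 2)) as [M HM].
replace (flim G x y) with (flim G x y - 0) by ring.
apply filterlim_ext with (fun n => G n (cell n x) (cell n y)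
  - D1 G n (cell n x - 1)%Z (cell n y) * step n).
{ intros n; unfold D1; replace (cell n x - 1 + 1)%Z with (cell n x) by ring; field.
  generalize (step_bounds n); lra. }
apply lim_minus; [apply flim_spec, G0|].
apply filterlim_squeeze0 with (M := M); intros n; assert (Hs := step_bounds n).
rewrite Rminus_0_r, Rabs_mult, (Rabs_right (step n)) by lra.
apply Rmult_le_compat_r; [lra|].
assert (Hx := Rabs_pos x); assert (Hy := Rabs_pos y).
assert (Hcx := cell_in_box n x r ltac:(unfold r; lra)).
assert (Hcy := cell_in_box n y r ltac:(unfold r; lra)).
apply HM; [|lra].
rewrite minus_IZR, Rmult_minus_distr_r, Rmult_1_l.
eapply Rle_trans; [apply Rabs_triang|]; rewrite Rabs_Ropp, (Rabs_right (step n)) by lra; lra.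
Qed.

Lemma Lap_lim (U : grid_family) (x y : R) :
  (forall m, Cb m U) ->
  filterlim (fun n => Lap U n (cell n x) (cell n y)) UF
    (locally (flim (D1 (D1 U)) x y + flim (D2 (D2 U)) x y)).
Proof.
intros HU.
apply filterlim_ext with (fun n => D1 (D1 U) n (cell n x - 1)%Z (cell n y)
  + D2 (D2 U) n (cell n x) (cell n y - 1)%Z).
- intros n; unfold D1, D2, Lap, lap, neighbours.
  replace (cell n x - 1 + 1)%Z with (cell n x) by ring.
  replace (cell n y - 1 + 1)%Z with (cell n y) by ring.
  field; generalize (step_bounds n); lra.
- apply lim_plus.
  + apply backward_shift_lim, (HU 3%nat).
  + apply (backward_shift_lim (swap (D2 (D2 U))) y x), Cb_swap, (HU 3%nat).
Qed.

Lemma polynomial_continuous (phi : C -> C) :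
  is_polynomial phi -> forall x y,
  continuity_2d_pt (fun x y => Re (phi (x, y))) x y /\
  continuity_2d_pt (fun x y => Im (phi (x, y))) x y.
Proof.
revert phi; apply (polynomial_horner_ind (fun phi => forall x y, _ /\ _)).
- intros c x y; split; apply continuity_2d_pt_const.
- intros c f H x y; destruct (H x y) as [HR HI].
  split; simpl; [apply continuity_2d_pt_plus; [apply continuity_2d_pt_const|];
    apply (continuity_2d_pt_minus (fun x y => x * Re (f (x, y))) (fun x y => y * Im (f (x, y)))) |
    apply continuity_2d_pt_plus; [apply continuity_2d_pt_const|];
    apply (continuity_2d_pt_plus (fun x y => x * Im (f (x, y))) (fun x y => y * Re (f (x, y))))];
  apply continuity_2d_pt_mult; trivial;
  first [apply continuity_2d_pt_id1 | apply continuity_2d_pt_id2].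
Qed.

Lemma flim_solution (k : nat) (phi : C -> C) (U : grid_family) :
  is_polynomial phi -> (forall m, Cb m U) ->
  (forall n i j, Lap U n i j = rhs k (Cmod (phi (grid_point n i j)) ^ 2) (U n i j)) ->
  forall z, laplacian (fun z => flim U (Re z) (Im z)) z
    = rhs k (Cmod (phi z) ^ 2) (flim U (Re z) (Im z)).
Proof.
intros Hphi HU HE [x y].
replace (laplacian _ _) with (flim (D1 (D1 U)) x y + flim (D2 (D2 U)) x y).
- apply (filterlim_locally_unique (F := UF) (fun n => Lap U n (cell n x) (cell n y)));
    [apply Lap_lim, HU|].
  apply filterlim_ext with (fun n => rhs k (Cmod (phi (grid_point n (cell n x) (cell n y))) ^ 2)
    (U n (cell n x) (cell n y))); [intros n; symmetry; apply HE|].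
  assert (LU := flim_spec U x y (proj1 (HU O))).
  destruct (polynomial_continuous phi Hphi x y) as [CR CI].
  unfold rhs; apply lim_minus; [apply lim_comp; [|exact LU]|apply lim_mult].
  + apply derivable_continuous_pt, derivable_pt_exp.
  + rewrite Cmod2_alt.
    apply filterlim_ext with (fun n => Re (phi (grid_point n (cell n x) (cell n y))) ^ 2
      + Im (phi (grid_point n (cell n x) (cell n y))) ^ 2);
      [intros n; symmetry; apply Cmod2_alt|].
    apply lim_plus; apply (lim_comp (fun t => t ^ 2));
      try (apply derivable_continuous_pt; reg).
    * apply (filterlim_2d UF (fun x y => Re (phi (x, y)))); [exact CR | apply cell_lim | apply cell_lim].
    * apply (filterlim_2d UF (fun x y => Im (phi (x, y)))); [exact CI | apply cell_lim | apply cell_lim].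
  + apply lim_comp; [apply derivable_continuous_pt, derivable_pt_exp|].
    apply lim_mult; [apply filterlim_const | exact LU].
- unfold laplacian, partial_derive, coords; cbn [Re Im fst snd Derive_n]; f_equal; symmetry.
  + rewrite (Derive_ext _ (fun t => flim (D1 U) t y));
      [apply Derive_flim_1, (HU 3%nat) | intros t; apply Derive_flim_1, HU].
  + rewrite (Derive_ext _ (fun t => flim (D2 U) x t));
      [apply Derive_flim_2, (HU 3%nat) | intros t; apply Derive_flim_2, HU].
Qed.

(** * Barriers *)


Lemma exp_monotone (x y : R) : x <= y -> exp x <= exp y.
Proof. intros [H| ->]; [left; apply exp_increasing, H | lra]. Qed.

Lemma rhs_monotone (k : nat) (q s t : R) :
  (1 <= k)%nat -> 0 <= q -> s <= t -> rhs k q s <= rhs k q t.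
Proof.
intros Hk Hq Hst; apply (le_INR 1) in Hk; simpl in Hk; unfold rhs.
assert (exp s <= exp t) by (apply exp_monotone, Hst).
assert (exp (- (INR k - 1) * t) <= exp (- (INR k - 1) * s)) by (apply exp_monotone; nra).
assert (q * exp (- (INR k - 1) * t) <= q * exp (- (INR k - 1) * s))
  by (apply Rmult_le_compat_l; assumption).
lra.
Qed.

Lemma rhs_continuous (k : nat) (q : R) : continuity (rhs k q).
Proof. unfold rhs; reg. Qed.

(** From [1 - cos t = 2 sin^2 (t / 2)] and [|sin s| <= |s|]. *)
Lemma cos_ge_quadratic (t : R) : 1 - t ^ 2 / 2 <= cos t.
Proof.
replace t with (2 * (t / 2)) at 2 by field; rewrite cos_2a_sin.
assert (H : Rabs (sin (t / 2)) <= Rabs (t / 2)).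
{ destruct (MVT_abs sin cos 0 (t / 2)) as (c & Hc & _); [intros; apply derivable_pt_lim_sin|].
  rewrite sin_0, !Rminus_0_r in Hc; rewrite Hc.
  assert (Rabs (cos c) <= 1) by (apply Rabs_le, COS_bound).
  generalize (Rabs_pos (t / 2)); nra. }
apply pow_maj_Rabs with (n := 2%nat) in H; rewrite pow2_abs in H; nra.
Qed.

(** On [[0, 1/2]] the cosine is at least [1 / 2], so [sin (t / 2) >= t / 4]. Together with
    [cos_ge_quadratic] this keeps [2 (1 - cos (a h)) / h^2] between [a^2 / 4] and [a^2], whatever
    the mesh, as long as [0 < a h <= 1]. *)
Lemma cos_le_quadratic (t : R) : 0 < t <= 1 -> cos t <= 1 - t ^ 2 / 8.
Proof.
intros Ht; replace t with (2 * (t / 2)) at 1 by field; rewrite cos_2a_sin.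
destruct (MVT_cor2 sin cos 0 (t / 2)) as (c & Hc & Hc2);
  [lra | intros; apply derivable_pt_lim_sin|].
rewrite sin_0, !Rminus_0_r in Hc.
assert (1 / 2 <= cos c) by (generalize (cos_ge_quadratic c); nra).
assert (t / 4 <= sin (t / 2)) by (rewrite Hc; nra).
nra.
Qed.

Lemma lap_quadratic (h A : R) (i j : Z) :
  0 < h ->
  lap h (fun i j => A * (1 + (IZR i * h) ^ 2 + (IZR j * h) ^ 2)) i j = 4 * A.
Proof.
intros Hh; unfold lap, neighbours; rewrite !plus_IZR, !minus_IZR; field; lra.
Qed.

(** By the addition formulas, cosines are exact eigenfunctions of the lattice Laplacian. *)
Lemma lap_cos (h a B : R) (i j : Z) :
  0 < h ->
  lap h (fun i j => - B - cos (a * (IZR i * h)) - cos (a * (IZR j * h))) i j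
  = 2 * (1 - cos (a * h)) / h ^ 2 * (cos (a * (IZR i * h)) + cos (a * (IZR j * h))).
Proof.
intros Hh.
assert (E : forall i, cos (a * (IZR (i + 1) * h)) + cos (a * (IZR (i - 1) * h))
  = 2 * cos (a * (IZR i * h)) * cos (a * h)).
{ intros l; rewrite plus_IZR, minus_IZR.
  replace (a * ((IZR l + 1) * h)) with (a * (IZR l * h) + a * h) by ring.
  replace (a * ((IZR l - 1) * h)) with (a * (IZR l * h) - a * h) by ring.
  rewrite cos_plus, cos_minus; ring. }
assert (Ei := E i); assert (Ej := E j); unfold lap, neighbours.
set (ci := cos (a * (IZR i * h))) in *; set (cj := cos (a * (IZR j * h))) in *.
replace (cos (a * (IZR (i + 1) * h))) with
  (2 * ci * cos (a * h) - cos (a * (IZR (i - 1) * h))) by lra.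
replace (cos (a * (IZR (j + 1) * h))) with
  (2 * cj * cos (a * h) - cos (a * (IZR (j - 1) * h))) by lra.
field; lra.
Qed.

Lemma Cmod_grid_point (n : nat) (i j : Z) :
  Cmod (grid_point n i j) ^ 2 = (IZR i * step n) ^ 2 + (IZR j * step n) ^ 2.
Proof. apply Cmod2_alt. Qed.

Lemma quadratic_supersolution (k : nat) (phi : C -> C) :
  (2 <= k)%nat -> is_polynomial phi ->
  exists A, 0 <= A /\ forall n i j,
    let vp := fun i j => A * (1 + (IZR i * step n) ^ 2 + (IZR j * step n) ^ 2) in
    lap (step n) vp i j <= rhs k (Cmod (phi (grid_point n i j)) ^ 2) (vp i j).
Proof.
intros Hk Hphi; destruct (polynomial_upper_bound phi Hphi) as (A0 & HA0 & H).
assert (Hk2 : 2 <= INR k) by (apply (le_INR 2), Hk).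
(* The part [2 * A0] gives [|phi|^2 <= exp v] for the value [v] of [vp], so the singular term is at
   most 1. The part 12 gives [exp v - 1 >= v + v^2 / 4 >= 4 v >= 4 A], and [4 A] is the
   Laplacian. *)
exists (2 * A0 + 12); split; [lra|]; intros n i j vp; unfold vp at 1.
rewrite lap_quadratic by apply step_bounds.
specialize (H (grid_point n i j)); rewrite Cmod_grid_point in H.
unfold vp; clear vp.
assert (Hx := pow2_ge_0 (IZR i * step n)); assert (Hy := pow2_ge_0 (IZR j * step n)).
set (s := (IZR i * step n) ^ 2 + (IZR j * step n) ^ 2) in *.
rewrite Rplus_assoc; fold s.
set (A := 2 * A0 + 12); set (v := A * (1 + s)).
assert (Hv : A <= v) by (unfold v, A, s; nra).
assert (HA : 12 <= A) by (unfold A; lra).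
assert (Hq : Cmod (phi (grid_point n i j)) ^ 2 <= exp v).
{ apply Rle_trans with (exp (A0 * (1 + s)) ^ 2).
  - apply pow_incr; split; [apply Cmod_ge_0 | exact H].
  - replace (exp (A0 * (1 + s)) ^ 2) with (exp (A0 * (1 + s) + A0 * (1 + s)))
      by (rewrite exp_plus; ring).
    apply exp_monotone; unfold v, A, s; nra. }
assert (He : Cmod (phi (grid_point n i j)) ^ 2 * exp (- (INR k - 1) * v) <= 1).
{ apply Rle_trans with (exp v * exp (- v)).
  - apply Rmult_le_compat; [apply pow2_ge_0 | left; apply exp_pos | exact Hq|].
    apply exp_monotone; nra.
  - rewrite <- exp_plus, Rplus_opp_r, exp_0; lra. }
assert (Hexp := exp_ge_quadratic v ltac:(lra)).
unfold rhs; nra.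
Qed.

(* Near the zeros of [phi] the cosines are positive, so the Laplacian dominates
   [exp vm]; far away the singular term [|phi|^2 exp (- (k - 1) vm)] dominates. *)
Lemma cosine_subsolution (k : nat) (phi : C -> C) :
  (2 <= k)%nat -> is_polynomial phi -> (exists z : C, phi z <> 0%C) ->
  exists a B, 2 <= B /\ forall n i j,
    let vm := fun i j => - B - cos (a * (IZR i * step n)) - cos (a * (IZR j * step n)) in
    rhs k (Cmod (phi (grid_point n i j)) ^ 2) (vm i j) <= lap (step n) vm i j.
Proof.
intros Hk Hphi [z1 Hz1].
destruct (polynomial_lower_bound phi Hphi) as [H|(r & c & Hc & Hr & H)];
  [contradiction (Hz1 (H z1))|].
assert (Hk2 : 2 <= INR k) by (apply (le_INR 2), Hk).
(* Low enough a frequency that [|a x|] and [|a y|] are at most 1 on the disc of radius [r], where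
   both cosines are then at least [1 / 2]. *)
set (a := / (r + 1)).
assert (Ha : 0 < a <= 1).
{ unfold a; split; [apply Rinv_0_lt_compat; lra|].
  rewrite <- Rinv_1; apply Rinv_le_contravar; lra. }
assert (Har : a * (r + 1) = 1) by (unfold a; field; lra).
assert (Ha2 : 0 < a ^ 2 <= 1) by nra.
assert (Hc2 : 0 < c ^ 2) by (apply pow_lt, Hc).
(* The 2 outweighs the cosines, so [vm <= - (B - 2)]. On the disc, [exp (B - 2) >= 4 / a^2] gives
   [exp vm <= a^2 / 4], below the Laplacian. Outside, [exp (B - 2) >= 3 / c^2] makes the singular
   term at least 3, so the right side is at most [1 - 3 = - 2], while the Laplacian is at least
   [- 2 a^2 >= - 2]. *)
set (B := 2 + 4 / a ^ 2 + 3 / c ^ 2).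
assert (Hpa : 0 < 4 / a ^ 2) by (apply Rdiv_lt_0_compat; lra).
assert (Hpc : 0 < 3 / c ^ 2) by (apply Rdiv_lt_0_compat; lra).
assert (HB : 1 + (B - 2) <= exp (B - 2)) by apply exp_ineq1_le.
exists a, B; split; [unfold B; lra|].
intros n i j vm; assert (Hs := step_bounds n); unfold vm.
rewrite lap_cos by lra.
set (l := 2 * (1 - cos (a * step n)) / step n ^ 2).
assert (Hh2 : 0 < step n ^ 2) by (apply pow_lt; lra).
assert (El : l * step n ^ 2 = 2 * (1 - cos (a * step n))) by (unfold l; field; lra).
assert (Hl : a ^ 2 / 4 <= l <= a ^ 2).
{ assert (L1 := cos_ge_quadratic (a * step n)).
  assert (L2 := cos_le_quadratic (a * step n) ltac:(nra)).
  split; apply Rmult_le_reg_r with (step n ^ 2); trivial; rewrite El;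
    rewrite Rpow_mult_distr in L1, L2; lra. }
clearbody l.
set (x := IZR i * step n); set (y := IZR j * step n).
assert (Cx := COS_bound (a * x)); assert (Cy := COS_bound (a * y)).
set (v := - B - cos (a * x) - cos (a * y)).
assert (Hv : v <= - (B - 2)) by (unfold v; lra).
assert (Hev : exp v * exp (B - 2) <= 1).
{ rewrite <- exp_plus, <- exp_0; apply exp_monotone; lra. }
assert (Hvp := exp_pos v).
unfold rhs.
destruct (Rle_lt_dec r (Cmod (grid_point n i j))) as [Hfar|Hnear].
- assert (Hq : c ^ 2 <= Cmod (phi (grid_point n i j)) ^ 2)
    by (apply pow_incr; split; [lra | apply H, Hfar]).
  assert (He : 3 / c ^ 2 <= exp (- (INR k - 1) * v)).
  { apply Rle_trans with (exp (B - 2)); [unfold B in HB |- *; lra|].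
    apply exp_monotone; unfold B in *; nra. }
  assert (H3 : 3 <= Cmod (phi (grid_point n i j)) ^ 2 * exp (- (INR k - 1) * v)).
  { apply Rle_trans with (c ^ 2 * (3 / c ^ 2)); [right; field; lra|].
    apply Rmult_le_compat; lra. }
  assert (exp v <= 1) by (rewrite <- exp_0; apply exp_monotone; unfold B in Hv; lra).
  nra.
- assert (Hxy : x ^ 2 + y ^ 2 <= r ^ 2).
  { unfold x, y; rewrite <- Cmod_grid_point; apply pow_incr.
    split; [apply Cmod_ge_0 | lra]. }
  assert (Hx2 := pow2_ge_0 x); assert (Hy2 := pow2_ge_0 y).
  assert (Har2 : a ^ 2 * r ^ 2 <= 1).
  { rewrite <- Rpow_mult_distr; replace 1 with (1 ^ 2) by ring.
    apply pow_incr; nra. }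
  assert (Hcx : 1 / 2 <= cos (a * x)).
  { eapply Rle_trans; [|apply cos_ge_quadratic]; rewrite Rpow_mult_distr; nra. }
  assert (Hcy : 1 / 2 <= cos (a * y)).
  { eapply Rle_trans; [|apply cos_ge_quadratic]; rewrite Rpow_mult_distr; nra. }
  assert (Hva : exp v <= a ^ 2 / 4).
  { apply Rmult_le_reg_r with (4 / a ^ 2); [exact Hpa|].
    replace (a ^ 2 / 4 * (4 / a ^ 2)) with 1 by (field; lra).
    eapply Rle_trans; [|exact Hev].
    apply Rmult_le_compat_l; [lra|]; unfold B in HB |- *; lra. }
  assert (0 <= Cmod (phi (grid_point n i j)) ^ 2 * exp (- (INR k - 1) * v))
    by (apply Rmult_le_pos; [apply pow2_ge_0 | left; apply exp_pos]).
  nra.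
Qed.

(** * From the barriers to the unique smooth solution *)

(** Both barriers are restrictions to the grid of functions on the plane that do not depend on the
    mesh; this is what makes the local bounds uniform in [n]. *)
Lemma discrete_solutions (k : nat) (phi : C -> C) :
  (2 <= k)%nat -> is_polynomial phi -> (exists z : C, phi z <> 0%C) ->
  exists U : grid_family, locally_bounded U /\ forall n i j,
    Lap U n i j = rhs k (Cmod (phi (grid_point n i j)) ^ 2) (U n i j).
Proof.
intros Hk Hphi Hz.
destruct (quadratic_supersolution k phi Hk Hphi) as (A & HA & Hp).
destruct (cosine_subsolution k phi Hk Hphi Hz) as (a & B & HB & Hm).
assert (HU : forall n, exists u : Z -> Z -> R,
  (forall i j, - B - cos (a * (IZR i * step n)) - cos (a * (IZR j * step n)) <= u i j
     <= A * (1 + (IZR i * step n) ^ 2 + (IZR j * step n) ^ 2)) /\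
  forall i j, lap (step n) u i j = rhs k (Cmod (phi (grid_point n i j)) ^ 2) (u i j)).
{ intros n.
  apply (lattice_solution (step n) (fun i j => rhs k (Cmod (phi (grid_point n i j)) ^ 2))
    (fun i j => - B - cos (a * (IZR i * step n)) - cos (a * (IZR j * step n)))
    (fun i j => A * (1 + (IZR i * step n) ^ 2 + (IZR j * step n) ^ 2))).
  - apply step_bounds.
  - intros i j s t; apply rhs_monotone; [lia | apply pow2_ge_0].
  - intros i j; apply rhs_continuous.
  (* The barriers are separated by 0, since [B >= 2] outweighs the two cosines. *)
  - intros i j.
    assert (Cx := COS_bound (a * (IZR i * step n))).
    assert (Cy := COS_bound (a * (IZR j * step n))).
    assert (0 <= A * (1 + (IZR i * step n) ^ 2 + (IZR j * step n) ^ 2)).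
    { apply Rmult_le_pos; [exact HA|].
      generalize (pow2_ge_0 (IZR i * step n)) (pow2_ge_0 (IZR j * step n)); lra. }
    lra.
  - intros i j; apply Hm.
  - intros i j; apply Hp. }
set (U := fun n => proj1_sig (constructive_indefinite_description _ (HU n))).
assert (HU' := fun n => proj2_sig (constructive_indefinite_description _ (HU n))).
exists U; split; [|intros n; apply (HU' n)].
intros r; exists (B + 2 + A * (1 + r ^ 2 + r ^ 2)); intros n i j Hi Hj.
destruct (proj1 (HU' n) i j) as [L1 L2]; fold (U n) in L1, L2.
assert (Cx := COS_bound (a * (IZR i * step n))).
assert (Cy := COS_bound (a * (IZR j * step n))).
apply pow_maj_Rabs with (n := 2%nat) in Hi, Hj.
assert (HA2 : A * (1 + (IZR i * step n) ^ 2 + (IZR j * step n) ^ 2)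
  <= A * (1 + r ^ 2 + r ^ 2)) by (apply Rmult_le_compat_l; lra).
assert (0 <= A * (1 + r ^ 2 + r ^ 2)).
{ apply Rmult_le_pos; [exact HA | generalize (pow2_ge_0 r); lra]. }
apply Rabs_le; split; lra.
Qed.

Theorem theorem1p1 :
  forall (k : nat) (phi : C -> C),
    (2 <= k)%nat ->
    is_polynomial phi ->
    (exists z : C, phi z <> 0%C) ->
    exists! w : C -> R,
      smooth w /\
      (forall z : C,
         laplacian w z
         = (exp (w z) - Cmod (phi z) ^ 2 * exp (- (INR k - 1) * w z))%R).
Proof.
intros k phi Hk Hphi Hz.
destruct (discrete_solutions k phi Hk Hphi Hz) as (U & HU & HE).
assert (HC := Cb_solution k _ U (fun m => Cb_polynomial_norm phi m Hphi) HU HE).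
set (w0 := fun z : C => flim U (Re z) (Im z)).
assert (S0 : smooth w0) by (intros n x y; exact (flim_smooth U n x y HC)).
assert (E0 := flim_solution k phi U Hphi HC HE : forall z,
  laplacian w0 z = rhs k (Cmod (phi z) ^ 2) (w0 z)).
exists w0; split; [exact (conj S0 E0)|].
intros w [Hw Ew]; apply functional_extensionality; intros z; apply Rle_antisym.
- exact (solution_le k phi w0 w Hk Hphi Hz S0 E0 Hw Ew z).
- exact (solution_le k phi w w0 Hk Hphi Hz Hw Ew S0 E0 z).
Qed.
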